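(* Let $\Sigma$ be given in a special coordinate basis (SCB) as in the context, strongly observable (so $n_a=n_c=0$), with $F_{dd}$ having the lower-block-triangular structure described in the context, and assume the unknown input $u_d$ is bounded. Let $\hat x_b$ be generated by the continuous bi-homogeneous observer $\dot{\hat x}_b=A_b^\star\hat x_b+H_{bb}y_b+H_{bd}y_d+B_{0b}y_0+l_b(e_{b,y})$ with parameters and gains chosen such that $x_b-\hat x_b$ vanishes after a time independent of initial conditions (as guaranteed by Theorem 3 in the context). Consider the observer $\dot{\hat x}_d=(A_d^\star+B_dF_{dd})\hat x_d+B_dF_{db}\hat x_b+B_{0d}y_0+H_{dd}y_d+l_d(e_{d,y})$, where $e_{d,y}=y_d-C_d\hat x_d$ has $i$-th component $e_{d,w_i}:=x_{d,w_i}-\hat x_{d,w_i}$ with $w_i=\sum_{j=1}^{i-1}q_j+1$, and $l_d:\mathbb R^{m_d}\to\mathbb R^{n_d}$ has component with index $w_i+j-1$ equal to $\kappa_{i,j}\Phi_j^{q_i}(e_{d,w_i})$, $i=1,\dots,m_d$, $j=1,\dots,q_i$, with the functions $\Phi_j^{q_i}$ of the context. Then for $d_0=-1$ and any constants $0<d_\infty<\min_{i=1,\dots,m_d}\frac{1}{q_i-1}$ ($\frac10:=+\infty$) and $0<\mu<1$, there exist gains $\kappa_{i,j}>0$ such that this is a fixed-time observer for the $d$-subsystem: there exists $T>0$, independent of the initial conditions, such that $x_d(t)-\hat x_d(t)=0$ for all $t\ge T$.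
   Context: Notation: for an integer $k\ge 1$, $J_k\in\mathbb R^{k\times k}$ is the matrix with ones on the first superdiagonal and zeros elsewhere, $B_k=[0\ \cdots\ 0\ 1]^\top\in\mathbb R^{k}$, $C_k=[1\ 0\ \cdots\ 0]\in\mathbb R^{1\times k}$, and $\mathrm{diag}(\cdot)$ denotes a (block) diagonal matrix. For $z\in\mathbb R$, $\lfloor z\rceil^a=\mathrm{sign}(z)|z|^a$ and $\lfloor z\rceil^0=\mathrm{sign}(z)$; solutions of differential equations with discontinuous right-hand side are understood in the sense of Filippov. Consider the linear time-invariant system $\Sigma$: $\dot x=Ax+Bu$, $y=Cx+Du$, with $x\in\mathbb R^n$, $u\in\mathbb R^m$, $y\in\mathbb R^p$, $\operatorname{rank}D=m_0$, and with $[B^\top\ D^\top]$ and $[C\ D]$ of full rank. Special coordinate basis (SCB): $\Sigma$ is in SCB if its state, input and output are partitioned as $x=(x_a,x_b,x_c,x_d)$ with $x_a\in\mathbb R^{n_a},x_b\in\mathbb R^{n_b},x_c\in\mathbb R^{n_c},x_d\in\mathbb R^{n_d}$, $u=(u_0,u_d,u_c)$ with $u_0\in\mathbb R^{m_0},u_d\in\mathbb R^{m_d},u_c\in\mathbb R^{m_c}$, $y=(y_0,y_d,y_b)$ with $y_0\in\mathbb R^{m_0},y_d\in\mathbb R^{m_d},y_b\in\mathbb R^{p_b}$, such that $y_0=C_{0a}x_a+C_{0b}x_b+C_{0c}x_c+C_{0d}x_d+u_0$, $y_d=C_dx_d$, $y_b=C_bx_b$, $\dot x_a=A_ax_a+H_{ab}C_bx_b+H_{ad}C_dx_d+B_{0a}y_0$,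 $\dot x_b=A_bx_b+H_{bd}C_dx_d+B_{0b}y_0$, $\dot x_c=B_cF_{ca}x_a+H_{cb}C_bx_b+A_cx_c+H_{cd}C_dx_d+B_{0c}y_0+B_cu_c$, $\dot x_d=B_dF_{da}x_a+B_dF_{db}x_b+B_dF_{dc}x_c+A_dx_d+B_{0d}y_0+B_du_d$, with constant real matrices of appropriate dimensions, where $A_b=\mathrm{diag}(J_{l_1},\dots,J_{l_{p_b}})+H_{bb}C_b$, $C_b=\mathrm{diag}(C_{l_1},\dots,C_{l_{p_b}})$ for positive integers $l_i$ with $\sum_i l_i=n_b$; $B_d=\mathrm{diag}(B_{q_1},\dots,B_{q_{m_d}})$, $C_d=\mathrm{diag}(C_{q_1},\dots,C_{q_{m_d}})$ for integers $q_1\ge q_2\ge\dots\ge q_{m_d}\ge 1$ with $\sum_i q_i=n_d$; and $A_d=A_d^\star+B_dF_{dd}+H_{dd}C_d$ with $A_d^\star=\mathrm{diag}(J_{q_1},\dots,J_{q_{m_d}})$, $F_{dd}\in\mathbb R^{m_d\times n_d}$, $H_{dd}\in\mathbb R^{n_d\times m_d}$. Also $A_b^\star:=\mathrm{diag}(J_{l_1},\dots,J_{l_{p_b}})$. Structure of $F_{dd}$: partition the columns of $F_{dd}$ into consecutive blocks of widths $q_1,\dots,q_{m_d}$ and denote by $f_{i,j,k}$ the entry of row $i$ in the $k$-th column of block $j$; the structure requires $f_{i,j,k}=0$ whenever $j\ge i$ or $k=1$. Strongly observable: $y\equiv0$ on $t\ge0$ implies $x\equiv0$, for all inputs and initial states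 (in SCB: $n_a=n_c=0$). Bi-homogeneous injection functions (Moreno): for an integer $N\ge1$ and parameters $0<\mu<1$, $-1\le d_0\le d_\infty$, set $r_{0,i}=1-(N-i)d_0$ and $r_{\infty,i}=1-(N-i)d_\infty$ for $i=1,\dots,N+1$, define $\phi_i^N(z)=\mu\lfloor z\rceil^{r_{0,i+1}/r_{0,i}}+(1-\mu)\lfloor z\rceil^{r_{\infty,i+1}/r_{\infty,i}}$ and $\Phi_i^N=\phi_i^N\circ\cdots\circ\phi_2^N\circ\phi_1^N$ for $i=1,\dots,N$. The injection $l_b:\mathbb R^{p_b}\to\mathbb R^{n_b}$ acts on $e_{b,y}=y_b-C_b\hat x_b$, whose $i$-th component is $e_{b,r_i}=x_{b,r_i}-\hat x_{b,r_i}$ with $r_i=\sum_{k<i}l_k+1$; its component with index $r_i+j-1$ is $\nu_{i,j}\Phi_j^{l_i}(e_{b,r_i})$. Theorem 3 (the paper's result used here): for any $0<\mu<1$ and $-1<d_0<0<d_\infty<\min_i\frac1{l_i-1}$ there exist gains $\nu_{i,j}>0$ such that $x_b-\hat x_b$ vanishes after a time independent of initial conditions. *)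

(* Defs.v *)
From HB Require Import structures.
From mathcomp Require Import all_boot all_order all_algebra.
From mathcomp Require Import all_classical all_reals all_analysis.
Set Implicit Arguments. Unset Strict Implicit. Unset Printing Implicit Defensive.
Import Order.TTheory GRing.Theory Num.Theory.
Local Open Scope ring_scope.
Local Open Scope classical_set_scope.

Section Defs.
Variable R : realType.

(* signed power  |_ z _|^a = sign(z) |z|^a ; for a = 0 this is sign(z) *)
Definition spow (z a : R) : R := Num.sg z * (`|z| `^ a).

(* r_i = 1 - (N - i) d   (i is 1-based, i = 1 .. N+1) *)
Definition rexp (d : R) (N i : nat) : R := 1 - (N%:R - i%:R) * d.

Definition phiN (mu d0 dinf : R) (N i : nat) (z : R) : R :=
  mu * spow z (rexp d0 N i.+1 / rexp d0 N i)
  + (1 - mu) * spow z (rexp dinf N i.+1 / rexp dinf N i).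

Fixpoint PhiN (mu d0 dinf : R) (N i : nat) (z : R) : R :=
  match i with
  | 0 => z
  | i'.+1 => phiN mu d0 dinf N i'.+1 (PhiN mu d0 dinf N i' z)
  end.

Definition bdim (k : nat) (q : 'I_k -> nat) : nat := \sum_(i < k) q i.

Definition boff (k : nat) (q : 'I_k -> nat) (i : 'I_k) : nat :=
  \sum_(j < k | (j < i)%N) q j.

(* diag(J_{q_1}, ..., J_{q_k}) *)
Definition Jblk (k : nat) (q : 'I_k -> nat) : 'M[R]_(bdim q) :=
  \matrix_(r, c)
    ([exists i : 'I_k, exists j : 'I_(q i),
        [&& (r : nat) == (boff q i + j)%N, (j.+1 < q i)%N & (c : nat) == r.+1]])%:R.

(* diag(B_{q_1}, ..., B_{q_k}) ; B_q = [0 .. 0 1]^T *)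
Definition Bblk (k : nat) (q : 'I_k -> nat) : 'M[R]_(bdim q, k) :=
  \matrix_(r, i) (((r : nat) == (boff q i + (q i).-1)%N) && (0 < q i)%N)%:R.

(* diag(C_{q_1}, ..., C_{q_k}) ; C_q = [1 0 .. 0] *)
Definition Cblk (k : nat) (q : 'I_k -> nat) : 'M[R]_(k, bdim q) :=
  \matrix_(i, c) (((c : nat) == boff q i) && (0 < q i)%N)%:R.

(* injection l(e) : component with (1-based) index  off_i + j  is
   g i j * Phi_j^{q_i}(e_i), i = 1..k, j = 1..q_i  *)
Definition linj (k : nat) (q : 'I_k -> nat) (mu d0 dinf : R)
    (g : 'I_k -> nat -> R) (e : 'cV[R]_k) : 'cV[R]_(bdim q) :=
  \col_r \sum_(i < k) \sum_(j < q i | (r : nat) == (boff q i + j)%N)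
           g i j.+1 * PhiN mu d0 dinf (q i) j.+1 (e i ord0).

Definition abs_cont (a b : R) (f : R -> R) : Prop :=
  forall eps : R, 0 < eps -> exists2 delta : R, 0 < delta &
    forall (m : nat) (s t : 'I_m -> R),
      (forall i, a <= s i /\ s i <= t i /\ t i <= b) ->
      (forall i j, i != j -> t i <= s j \/ t j <= s i) ->
      \sum_(i < m) (t i - s i) < delta ->
      \sum_(i < m) `| f (t i) - f (s i) | < eps.

Definition ae_pos (P : R -> Prop) : Prop :=
  exists2 N : set R, (@lebesgue_measure R).-negligible N &
    forall t, 0 <= t -> ~ N t -> P t.

Definition null_set (n : nat) (N : set 'cV[R]_n) : Prop :=
  forall eps : R, 0 < eps -> exists a b : nat -> 'cV[R]_n,
    [/\ (forall k i, a k i ord0 <= b k i ord0),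
        (forall x, N x -> exists k, forall i,
            a k i ord0 <= x i ord0 /\ x i ord0 <= b k i ord0) &
        (forall m, \sum_(k < m) \prod_(i < n) (b k i ord0 - a k i ord0) < eps)].

Definition sball (n : nat) (x : 'cV[R]_n) (delta : R) : set 'cV[R]_n :=
  [set y | forall i, `| y i ord0 - x i ord0 | < delta].

Definition conv_hull (n : nat) (S : set 'cV[R]_n) : set 'cV[R]_n :=
  [set v | exists (m : nat) (w : 'I_m -> R) (p : 'I_m -> 'cV[R]_n),
     [/\ forall i, 0 <= w i, \sum_(i < m) w i = 1, forall i, S (p i)
       & v = \sum_(i < m) w i *: p i]].

Definition sclosure (n : nat) (S : set 'cV[R]_n) : set 'cV[R]_n :=
  [set v | forall eps : R, 0 < eps -> exists2 s, S s & sball v eps s].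

Definition filippov (n : nat) (f : 'cV[R]_n -> 'cV[R]_n) (x : 'cV[R]_n)
  : set 'cV[R]_n :=
  [set v | forall delta : R, 0 < delta -> forall N : set 'cV[R]_n, null_set N ->
       sclosure (conv_hull (f @` (sball x delta `\` N))) v].

Definition loc_ac (n : nat) (z : R -> 'cV[R]_n) : Prop :=
  forall (T : R) (i : 'I_n), 0 <= T -> abs_cont 0 T (fun t => z t i ord0).

Definition dvec (n : nat) (z : R -> 'cV[R]_n) (t : R) : 'cV[R]_n :=
  \col_i (fun s => z s i ord0)^`() t.

Definition dvec_ex (n : nat) (z : R -> 'cV[R]_n) (t : R) : Prop :=
  forall i, derivable (fun s => z s i ord0) t 1.

Definition filippov_sol (n : nat) (f : R -> 'cV[R]_n -> 'cV[R]_n)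
    (z : R -> 'cV[R]_n) : Prop :=
  loc_ac z /\ ae_pos (fun t => dvec_ex z t /\ filippov (f t) (z t) (dvec z t)).

(* z is a (Caratheodory) solution of dz/dt = g(t)  (g given along it) *)
Definition cara_sol (n : nat) (z : R -> 'cV[R]_n) (g : R -> 'cV[R]_n) : Prop :=
  loc_ac z /\ ae_pos (fun t => dvec_ex z t /\ dvec z t = g t).

End Defs.

Arguments Jblk {R k} q.
Arguments Bblk {R k} q.
Arguments Cblk {R k} q.

(* Main.v *)
(** After the time [Tb] the estimate of [x_b] is exact, and the structure of
    [F_dd] makes the [i]-th block of the error [x_d - xhat_d] an autonomous
    chain once the preceding blocks have vanished. It remains to treat one chain
      [e_i' = e_{i+1} - kappa_i Phi_i(e_1)], with a bounded perturbation in the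
    last equation.

    With [kappa_i = k_1 ... k_i] and [x_i = e_i / kappa_{i-1}] the chain becomes
    [x_i' = k_i (x_{i+1} - Phi_i(x_1))]. Scaling by [rho_i = R^(r_{0,i})] for
    [R <= 1] and by [R^(r_{oo,i})] for [R >= 1] replaces [phi_i] by
    [a |_z_|^al + b |_z_|^be] with [a, b] in a compact set and multiplies all
    speeds by the same [u = R^-1] or [u = R^d_oo]. For the scaled chain one
    shrinks the region where each [x_i] stays within a small distance of
    [phi_i^-1(x_{i+1})], the tolerances forming a hierarchy that grows with [i];
    if the [k_i] are chosen from the last one down, each much larger than the
    next, the flow points inwards on every face. Hence a box of fixed size is
    contracted by a fixed factor in time [1/u], and the contraction times over
    [R = 2^j], then [R = 2^-j], are summable. *)
Require Import Defs.
From HB Require Import structures.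
From mathcomp Require Import all_boot all_order all_algebra.
From mathcomp Require Import all_classical all_reals all_analysis.
From mathcomp Require Import ring lra zify.
Set Implicit Arguments. Unset Strict Implicit. Unset Printing Implicit Defensive.
Import Order.TTheory GRing.Theory Num.Theory.
Import numFieldNormedType.Exports.
Local Open Scope ring_scope.

(** * Increments of absolutely continuous functions *)

Section AbsoluteContinuity.
Variable R : realType.
Implicit Types (a b A : R) (f : R -> R).

(** The obstacle is that the scaled [phi_i] are not Lipschitz at 0 and that their inverses need not
    be, so errors in successive coordinates cannot be compared linearly. The tolerances are
    therefore powers [c_i b^(n+1-i)] of one parameter [b], with [i] counted from 0: the lower
    exponent [(n-i)/(n+1-i)] of [phi_i] turns each power into the next one. So one choice of the
    [c_i] serves every [b] in [[b1, 1]], and contraction is a slow decrease of [b]. A small linear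
    term added to [phi_i] converts inward motion of [x_i] into a margin over the speed of [x_{i+1}].
    Neither the tolerances nor [b1] depend on its slope or on the gains, so the choices are not
    circular.

    The value [d_0 = -1] acts through the weight [r_{0,N+1} = 0]: on small scales the switching term
    keeps its size, as the perturbation does, and [mu kappa_N >= 2 L] leaves half of it available at
    every scale. The box is shrunk by [2^-N], at least as much as any coordinate size changes when
    [R] is halved, so the same gains serve the next scale. *)

Lemma real_induction a b (P : R -> Prop) :
  P a ->
  (forall x, a <= x < b -> (forall r, a <= r <= x -> P r) ->
     exists2 h, 0 < h & forall r, x < r < x + h -> r <= b -> P r) ->
  (forall x, a < x <= b -> (forall r, a <= r < x -> P r) -> P x) ->
  forall x, a <= x <= b -> P x.
Proof.
move=> Pa Pright Pleft x0 /andP[ax0 x0b].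
pose S := [set x | a <= x <= b /\ forall r, a <= r <= x -> P r]%classic.
have Sa : S a.
  split; first by rewrite lexx (le_trans ax0).
  by move=> r /le_anti <-.
have supS : has_sup S by split; [exists a | exists b => x [/andP[]]].
pose s := sup S.
have as_ : a <= s by apply: ub_le_sup => //; exact: supS.2.
have sb : s <= b by apply: ge_sup; [exists a | move=> x [/andP[]]].
have Plt r : a <= r < s -> P r.
  move=> /andP[ar rs].
  have [x Sx rx] := sup_gt supS.1 rs.
  by apply: Sx.2; rewrite ar ltW.
have Ps : P s.
  have [<-//|nas] := eqVneq a s.
  by apply: Pleft => //; rewrite lt_neqAle nas as_ sb.
have Ple r : a <= r <= s -> P r.
  move=> /andP[ar]; rewrite le_eqVlt => /orP[/eqP->//|rs].
  by apply: Plt; rewrite ar.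
have [sb'|bs] := ltP s b; last first.
  by apply: Ple; rewrite ax0 (le_trans x0b).
have [|h h0 Ph] := Pright s _ Ple; first by rewrite as_.
pose t := s + Num.min (h / 2) (b - s).
have st : s < t by rewrite ltrDl lt_min; apply/andP; split; lra.
have tb : t <= b.
  have : Num.min (h / 2) (b - s) <= b - s by rewrite ge_min lexx orbT.
  by rewrite /t; lra.
have th : t < s + h.
  have : Num.min (h / 2) (b - s) <= h / 2 by rewrite ge_min lexx.
  by rewrite /t; lra.
suff /(ub_le_sup supS.2) : S t by rewrite leNgt st.
split; first by rewrite tb (le_trans as_) // ltW.
move=> r /andP[ar rt]; have [rs|sr] := leP r s; first by apply: Ple; rewrite ar.
by apply: Ph; [rewrite sr (le_lt_trans rt) | exact: le_trans tb].
Qed.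

(** Compactness in the form used by gauge integrals: each point only carries [P] across short
    intervals that contain it, and no finite cover has to be selected. *)
Lemma cousin_chain a b (P : R -> Prop) :
  P a ->
  (forall x, a <= x <= b -> exists2 h, 0 < h &
     forall r s, a <= r -> s <= b -> x - h < r -> r <= x -> x <= s -> s < x + h ->
       P r -> P s) ->
  forall x, a <= x <= b -> P x.
Proof.
move=> Pa gauge; apply: real_induction => // x /andP[ax xb] Px.
- have [|h h0 Ph] := gauge x; first by rewrite ax ltW.
  exists h => // r /andP[xr rh] rb.
  apply: (Ph x r) => //; first by lra.
    exact: ltW.
  by apply: Px; rewrite ax lexx.
- have [|h h0 Ph] := gauge x; first by rewrite xb ltW.
  pose r := Num.max a (x - h / 2).
  have rx : r < x by rewrite gt_max ax /=; lra.
  have ar : a <= r by rewrite le_max lexx.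
  have hr : x - h / 2 <= r by rewrite le_max lexx orbT.
  apply: (Ph r x) => //; [by lra|exact: ltW|by lra|].
  by apply: Px; rewrite ar.
Qed.

Local Notation leb := (@lebesgue_measure R).

Lemma negligible_cover (N : set R) eps : leb.-negligible N -> 0 < eps ->
  exists U : set R, [/\ open U, (N `<=` U)%classic & (leb U < eps%:E)%E].
Proof.
move=> [B [mB B0 NB]] eps0.
have [|U [oU BU UB]] := lebesgue_regularity_outer mB _ eps0.
  by rewrite [X in (X < _)%E]B0 ltry.
exists U; split => //; first exact: subset_trans BU.
rewrite -(setDUK BU) measureU //; last 2 first.
- by apply: measurableD => //; exact: measurable_realfun.open_measurable.
- by rewrite setDIK.
by rewrite [X in (X + _ < _)%E]B0 add0e.
Qed.

(** The straddle estimate: differentiability at the single point [x] controls every short interval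
    around it, by adding the increments on its two sides. *)
Lemma derive1_increment_ub f (x A e : R) :
  derivable f x 1 -> derive1 f x <= A -> 0 < e ->
  exists2 h, 0 < h & forall r s, x - h < r -> r <= x -> x <= s -> s < x + h ->
    f s - f r <= (A + e) * (s - r).
Proof.
move=> df fA e0.
have : (h^-1 *: (f (h + x) - f x) @[h --> 0^'] --> derive1 f x)%classic.
  move: df; rewrite /derivable /derive1 /=.
  by under eq_fun do rewrite -[_ *: 1]/(_ * 1) mulr1 -[_ + x]/(_ + x).
move/cvgrPdist_lt => /(_ e e0) [d /= d0 dP].
have bnd h : `|h| < d -> h != 0 -> h^-1 * (f (h + x) - f x) < A + e.
  move=> hd h0; have := dP h; rewrite /ball /= sub0r normrN => /(_ hd h0).
  by rewrite ltr_norml -[_ *: _]/(_ * _) => /andP[+ _]; lra.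
have right y : x <= y -> y < x + d -> f y - f x <= (A + e) * (y - x).
  rewrite le_eqVlt => /orP[/eqP <-|xy yd]; first by rewrite !subrr mulr0.
  have := bnd (y - x); rewrite subrK gtr0_norm ?subr_gt0// => /(_ _ _)/ltW.
  by rewrite mulrC ler_pdivrMr ?subr_gt0//; apply; [lra|rewrite gt_eqF ?subr_gt0].
have left y : y <= x -> x - d < y -> f x - f y <= (A + e) * (x - y).
  rewrite le_eqVlt => /orP[/eqP ->|xy yd]; first by rewrite !subrr mulr0.
  have := bnd (y - x); rewrite subrK ltr0_norm ?subr_lt0// => /(_ _ _)/ltW.
  rewrite -[f y - f x]opprB mulrN -mulNr -invrN opprB mulrC ler_pdivrMr ?subr_gt0//.
  by apply; [lra|rewrite lt_eqF ?subr_lt0].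
exists d => // r s xr rx xs sx.
have := right _ xs sx; have := left _ rx xr; lra.
Qed.

(* A gauge argument: off N the derivative controls the increments, and the
   intervals tagged in N lie in an open set of small measure, where absolute
   continuity bounds the total increment. *)
Lemma abs_cont_increment_ub a b f A (N : set R) : a <= b ->
  abs_cont a b f -> leb.-negligible N ->
  (forall t, a <= t <= b -> ~ N t -> derivable f t 1 /\ derive1 f t <= A) ->
  f b - f a <= A * (b - a).
Proof.
move=> ab acf nN df; apply/ler_addgt0Pr => eps eps0.
(* The three thirds of [eps] pay for the error in the slope, for the variation on the bad intervals
   and for the correction [c]. The [+ 1] keeps the denominator positive when [a = b]. *)
pose e1 := eps / (3 * (b - a + 1)).
have ba1 : 0 < b - a + 1 by lra.
have e10 : 0 < e1 by rewrite divr_gt0// mulr_gt0.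
have [d1 d10 acd] := acf _ (divr_gt0 eps0 (ltr0n _ 3)).
pose c := `|A + e1| + 1; have c0 : 0 < c by rewrite ltr_wpDl.
pose dl := Num.min d1 (eps / (3 * c)).
have dl0 : 0 < dl by rewrite lt_min d10 divr_gt0// mulr_gt0.
have [U [oU NU Udl]] := negligible_cover nN dl0.
have mU : measurable U by exact: measurable_realfun.open_measurable.
(* The family collects the intervals tagged in [N], where the slope bound is replaced by
   [|f (t i) - f (s i)|]; [c] times their length compensates for a negative [A + e1]. The half-open
   [[a, x[] makes the measures of consecutive pieces add up. *)
pose P x := exists m (s t : 'I_m -> R),
  [/\ forall i, a <= s i /\ s i <= t i /\ t i <= x,
      forall i j, i != j -> t i <= s j \/ t j <= s i,
      ((\sum_(i < m) (t i - s i))%:E <= leb (U `&` `[a, x[%classic))%E &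
      f x - f a <= (A + e1) * (x - a) +
        (\sum_(i < m) `|f (t i) - f (s i)| + c * \sum_(i < m) (t i - s i))].
have [m [s [t [st disj len incr]]]] : P b.
  apply: (@cousin_chain a b P); last by rewrite ab lexx.
    exists 0, (fun=> 0), (fun=> 0); split => //; try by case.
    - by rewrite big_ord0.
    - by rewrite !big_ord0 !subrr !mulr0 !addr0.
  move=> x axb; have [Nx|nNx] := pselect (N x).
    have /nbhs_ballP[h /= h0 hU] : nbhs x U.
      by apply: open_nbhs_nbhs; split => //; exact: NU.
    exists h => // r s ar sb xhr rx xs sxh [m [ss [tt [st disj len incr]]]].
    have rs : r <= s by exact: le_trans xs.
    pose s' (i : 'I_m.+1) := if unlift ord_max i is Some j then ss j else r.
    pose t' (i : 'I_m.+1) := if unlift ord_max i is Some j then tt j else s.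
    have wE (i : 'I_m) : widen_ord (leqnSn m) i = lift ord_max i.
      by apply/val_inj; rewrite /= /bump leqNgt ltn_ord.
    have s'E (i : 'I_m) : s' (widen_ord (leqnSn m) i) = ss i by rewrite wE /s' liftK.
    have t'E (i : 'I_m) : t' (widen_ord (leqnSn m) i) = tt i by rewrite wE /t' liftK.
    have s'm : s' ord_max = r by rewrite /s' unlift_none.
    have t'm : t' ord_max = s by rewrite /t' unlift_none.
    exists m.+1, s', t'; split.
    - move=> i; rewrite /s' /t'; case: unliftP => [j _|_] //.
      by have [? [? ?]] := st j; split => //; split => //; exact: le_trans rs.
    - move=> i j; rewrite /s' /t'.
      case: unliftP => [i'|] ->; case: unliftP => [j'|] -> //.
      + by move=> ij; apply: disj; apply: contraNneq ij => ->.
      + by move=> _; left; have [_ []] := st i'.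
      + by move=> _; right; have [_ []] := st j'.
      + by rewrite eqxx.
    - rewrite big_ord_recr /= s'm t'm.
      under eq_bigr do rewrite s'E t'E.
      rewrite EFinD.
      have -> : (U `&` `[a, s[ = (U `&` `[a, r[) `|` `[r, s[)%classic.
        apply/seteqP; split => y /=; rewrite !in_itv /=.
          move=> [Uy /andP[ay ys]]; have [yr|ry] := ltP y r.
            by left; rewrite ay.
          by right; rewrite ys.
        move=> [[Uy /andP[ay yr]]|/andP[ry ys]].
          by split => //; rewrite ay (lt_le_trans yr).
        split; last by rewrite ys (le_trans ar).
        apply: hU; rewrite /ball /= ltr_norml; apply/andP; split; lra.
      rewrite measureU //; last 2 first.
      + by apply: measurableI.
      + apply/seteqP; split => y //=; rewrite !in_itv /= => -[[_ /andP[_ ?]] /andP[? _]].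
        lra.
      apply: leeD => //.
      rewrite [leRHS](@lebesgue_measure_itv R `[r, s[) /= lte_fin.
      by case: ltP => [//|sr]; rewrite lee_fin; lra.
    - rewrite !big_ord_recr /= s'm t'm.
      under eq_bigr do rewrite s'E t'E.
      under [in X in c * X]eq_bigr do rewrite s'E t'E.
      have : f s - f r <= `|f s - f r| by exact: ler_norm.
      have : - (A + e1) * (s - r) <= c * (s - r).
        apply: ler_wpM2r; first by lra.
        by have := ler_norm (- (A + e1)); rewrite normrN /c; lra.
      lra.
  have [dx dxA] := df _ axb nNx.
  have [h h0 hP] := derive1_increment_ub dx dxA e10.
  exists h => // r s ar sb xhr rx xs sxh [m [ss [tt [st disj len incr]]]].
  have rs : r <= s by exact: le_trans xs.
  exists m, ss, tt; split => //.
  - by move=> i; have [? [? ?]] := st i; split => //; split => //; exact: le_trans rs.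
  - apply: (le_trans len); apply: le_measure; rewrite ?inE; [exact: measurableI..|].
    move=> y /= [Uy]; rewrite !in_itv /= => /andP[-> yr]; split => //=.
    exact: lt_le_trans rs.
  - have := hP _ _ xhr rx xs sxh; move: incr; clear; set S1 := (\sum_(i < m) _ + _); lra.
have len2 : \sum_(i < m) (t i - s i) < dl.
  rewrite -lte_fin; apply: le_lt_trans Udl; apply: (le_trans len).
  by apply: le_measure; rewrite ?inE //; exact: measurableI.
have /acd : \sum_(i < m) (t i - s i) < d1 by rewrite (lt_le_trans len2)// ge_min lexx.
move=> /(_ st disj) acb.
have len3 : c * \sum_(i < m) (t i - s i) <= eps / 3.
  rewrite mulrC -ler_pdivlMr // (le_trans (ltW len2)) // ge_min; apply/orP; right.
  by rewrite invfM mulrA.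
have e1b : e1 * (b - a) <= eps / 3.
  have -> : eps / 3 = e1 * (b - a + 1).
    by rewrite /e1; field; rewrite gt_eqF.
  by rewrite ler_pM2l//; lra.
lra.
Qed.

Lemma abs_cont_increment_lb a b f A (N : set R) : a <= b ->
  abs_cont a b f -> leb.-negligible N ->
  (forall t, a <= t <= b -> ~ N t -> derivable f t 1 /\ A <= derive1 f t) ->
  A * (b - a) <= f b - f a.
Proof.
move=> ab acf nN df.
have abN := @abs_cont_increment_ub a b (fun x => - f x) (- A) N ab.
suff : - f b - - f a <= (- A) * (b - a) by move=> {}abN; lra.
apply: abN nN _.
  move=> e e0; have [d d0 dP] := acf _ e0; exists d => // m s t st disj len.
  by under eq_bigr do rewrite -opprB normrN opprK addrC; exact: dP.
move=> t tab nNt; have [dft fA] := df t tab nNt; split; first exact: derivableN.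
by rewrite derive1E deriveN // lerN2 -derive1E.
Qed.
End AbsoluteContinuity.

(** * Signed powers *)

Section SignedPower.
Variable R : realType.
Implicit Types (x y z p r M d : R).

Lemma spow0 p : spow 0 p = 0.
Proof. by rewrite /spow sgr0 mul0r. Qed.

Lemma spowN z p : spow (- z) p = - spow z p.
Proof. by rewrite /spow sgrN normrN mulNr. Qed.

Lemma spow_gt0E z p : 0 < z -> spow z p = z `^ p.
Proof. by move=> z0; rewrite /spow gtr0_sg// mul1r gtr0_norm. Qed.

Lemma spow_ge0E z p : p != 0 -> 0 <= z -> spow z p = z `^ p.
Proof.
by move=> p0; rewrite le_eqVlt => /orP[/eqP <-|/spow_gt0E//]; rewrite spow0 powR0.
Qed.

Lemma norm_spow z p : `|spow z p| <= `|z| `^ p.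
Proof.
rewrite /spow normrM [X in _ * X]ger0_norm ?powR_ge0// normr_sg.
by rewrite ler_piMl ?powR_ge0//; case: eqP => //=; rewrite ?ler01.
Qed.

Lemma spowMl r z p : 0 < r -> spow (r * z) p = r `^ p * spow z p.
Proof.
move=> r0; rewrite /spow sgrM gtr0_sg// mul1r normrM gtr0_norm//.
by rewrite powRM// ?(ltW r0)// mulrCA.
Qed.

Lemma spow_lt p : 0 < p -> {homo (fun z => spow z p) : x y / x < y}.
Proof.
move=> p0.
have pos x y : 0 <= x -> x < y -> spow x p < spow y p.
  move=> x0 xy; rewrite !spow_ge0E ?gt_eqF ?(ltW (le_lt_trans x0 xy))//.
  by apply: gt0_ltr_powR => //; rewrite nnegrE ltW// (le_lt_trans x0).
move=> x y xy; have [x0|x0] := leP 0 x; first exact: pos.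
have [y0|y0] := leP y 0.
  by rewrite -ltrN2 -!spowN; apply: pos; lra.
apply: (@lt_trans _ _ 0); last by rewrite -(spow0 p); exact: pos.
by rewrite -oppr_gt0 -spowN -(spow0 p); apply: pos; lra.
Qed.

Lemma spow_le p : 0 < p -> {homo (fun z => spow z p) : x y / x <= y}.
Proof.
by move=> p0 x y; rewrite le_eqVlt => /orP[/eqP ->//|/(spow_lt p0)/ltW].
Qed.

(** A fraction [t <= 1] satisfies [t <= t^p]; apply this to [x / (x + y)] and [y / (x + y)], whose
    sum is 1. *)
Lemma powR_subadditive p x y : 0 <= p <= 1 -> 0 <= x -> 0 <= y ->
  (x + y) `^ p <= x `^ p + y `^ p.
Proof.
move=> /andP[p0 p1] x0 y0.
have [/eqP|s0] := eqVneq (x + y) 0.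
  rewrite paddr_eq0 // => /andP[/eqP -> /eqP ->].
  by rewrite addr0 lerDl powR_ge0.
have s_gt0 : 0 < x + y by rewrite lt_neqAle eq_sym s0 addr_ge0.
have frac z : 0 <= z -> z <= x + y -> z / (x + y) * (x + y) `^ p <= z `^ p.
  move=> z0 zs; have [->|zn0] := eqVneq z 0; first by rewrite !mul0r powR_ge0.
  have z_gt0 : 0 < z by rewrite lt_neqAle eq_sym zn0.
  rewrite -{2}(divfK s0 z) powRM ?divr_ge0 ?(ltW s_gt0)//.
  rewrite ler_wpM2r ?powR_ge0// ger1_powR// divr_gt0//=.
  by rewrite ler_pdivrMr// mul1r.
have := lerD (frac x x0 _) (frac y y0 _); rewrite lerDl lerDr -!mulrDl divff// mul1r.
exact.
Qed.

(** The factor 2 serves opposite signs, where each of the two powers is at most [|x - y|^p]; for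
    equal signs subadditivity would give 1. *)
Lemma spow_holder p x y : 0 < p <= 1 ->
  `|spow x p - spow y p| <= 2 * `|x - y| `^ p.
Proof.
move=> /andP[p0 p1].
have p01 : 0 <= p <= 1 by rewrite ltW.
have pn0 : p != 0 by rewrite gt_eqF.
wlog yx : x y / y <= x.
  by move=> H; case: (leP y x) => [/H//|/ltW/H]; rewrite distrC [`|y - x|]distrC.
rewrite ger0_norm ?subr_ge0 ?spow_le// [`|x - y|]ger0_norm ?subr_ge0//.
have same u v : 0 <= v -> v <= u -> spow u p - spow v p <= 2 * (u - v) `^ p.
  move=> v0 vu; rewrite !spow_ge0E ?(le_trans v0 vu)//.
  have := @powR_subadditive p (u - v) v p01; rewrite subr_ge0 subrK => /(_ vu v0).
  by have := powR_ge0 (u - v) p; lra.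
have [y0|y0] := leP 0 y; first exact: same.
have [x0|x0] := leP x 0.
  have -> : spow x p - spow y p = spow (- y) p - spow (- x) p.
    by rewrite !spowN opprK addrC.
  have -> : x - y = - y - - x by rewrite opprK addrC.
  by apply: same; lra.
rewrite -[y]opprK spowN opprK !spow_gt0E ?oppr_gt0// opprK mulr2n mulrDl mul1r.
by apply: lerD; apply: ge0_ler_powR; rewrite ?nnegrE; lra.
Qed.

(** For an integer [n >= p] and [t = y / x] in [[0, 1]], [1 - t^p <= 1 - t^n <= n (1 - t)]; no
    derivative is taken. *)
Lemma spow_lipschitz p M : 1 <= p -> 0 < M -> exists2 C : R, 0 < C &
  forall x y, `|x| <= M -> `|y| <= M -> `|spow x p - spow y p| <= C * `|x - y|.
Proof.
move=> p1 M0.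
have p0 : 0 < p by exact: lt_le_trans p1.
have pn0 : p != 0 by rewrite gt_eqF.
pose n := (Num.bound p).+1.
have pn : p <= n%:R.
  by rewrite (le_trans (ltW (archi_boundP (ltW p0))))// ler_nat.
pose C := n%:R * M `^ (p - 1).
have M1 : 0 < M `^ (p - 1) by rewrite powR_gt0.
have MC : M `^ (p - 1) <= C by rewrite ler_peMl ?(ltW M1)// ler1n.
have pw z : 0 <= z -> z <= M -> z `^ p <= M `^ (p - 1) * z.
  move=> z0 zM; rewrite -mulr_powRB1// mulrC ler_wpM2r// ge0_ler_powR ?subr_ge0//.
  by rewrite nnegrE ltW.
have same x y : 0 <= y -> y <= x -> x <= M -> spow x p - spow y p <= C * (x - y).
  move=> y0 yx xM; rewrite !spow_ge0E ?(le_trans y0 yx)//.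
  have [x0|xn0] := eqVneq x 0.
    have -> : y = x by lra.
    by rewrite !subrr mulr0.
  have x0 : 0 < x by lra.
  pose t := y / x.
  have t01 : 0 <= t <= 1 by rewrite divr_ge0 ?ler_pdivrMr ?mul1r// ltW.
  have bern : 1 - t `^ p <= n%:R * (1 - t).
    have tn : t ^+ n <= t `^ p.
      have [/andP[tge0 tle1]] := t01.
      have [->|tn0] := eqVneq t 0; first by rewrite expr0n powR_ge0.
      by rewrite -powR_mulrn // ger_powR// lt_neqAle eq_sym tn0 tge0.
    suff : 1 - t ^+ n <= n%:R * (1 - t) by lra.
    elim: {tn pn C MC}n => [|k IH]; first by rewrite expr0 subrr mul0r.
    rewrite exprS -natr1; move/andP: t01 => [t0 t1].
    have : t ^+ k <= 1 by rewrite exprn_ile1.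
    have : 0 <= t ^+ k by rewrite exprn_ge0.
    nra.
  have -> : y = x * t by rewrite mulrC divfK.
  rewrite powRM ?(ltW x0) ?(andP t01).1//.
  have -> : x `^ p - x `^ p * t `^ p = x `^ p * (1 - t `^ p) by ring.
  have -> : C * (x - x * t) = (M `^ (p - 1) * x) * (n%:R * (1 - t)).
    by rewrite /C; ring.
  apply: (@le_trans _ _ (x `^ p * (n%:R * (1 - t)))).
    by rewrite ler_wpM2l ?powR_ge0.
  apply: ler_wpM2r; first by rewrite mulr_ge0 ?subr_ge0 ?(andP t01).2.
  by apply: pw => //; exact: ltW.
exists C; first by rewrite mulr_gt0.
move=> x y; wlog yx : x y / y <= x.
  by move=> H; case: (leP y x) => [/H//|/ltW/H + xM yM]; rewrite distrC [`|y - x|]distrC; apply.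
rewrite ler_norml => /andP[Mx xM]; rewrite ler_norml => /andP[My yM].
rewrite ger0_norm ?subr_ge0 ?spow_le// [`|x - y|]ger0_norm ?subr_ge0//.
have [y0|y0] := leP 0 y; first exact: same.
have [x0|x0] := leP x 0.
  have -> : spow x p - spow y p = spow (- y) p - spow (- x) p.
    by rewrite !spowN opprK addrC.
  have -> : x - y = - y - - x by rewrite opprK addrC.
  by apply: same; lra.
rewrite -[y]opprK spowN opprK !spow_gt0E ?oppr_gt0// opprK.
have := pw x (ltW x0) xM; have := pw (- y); rewrite oppr_ge0 (ltW y0).
move=> /(_ isT) H1 H2.
have H3 : M `^ (p - 1) * (x - y) <= C * (x - y) by rewrite ler_wpM2r //; lra.
by have := H1 ltac:(lra); lra.
Qed.

Lemma spow_continuous p : 0 < p -> continuous (fun z => spow z p).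
Proof.
move=> p0 z; apply/cvgrPdist_le => e e0.
have close d : 0 < d -> \forall x \near z, `|z - x| <= d.
  by move=> d0; apply/nbhs_ballP; exists d => //= x /ltW.
have [p1|p1] := leP p 1.
  near=> x; apply: (le_trans (spow_holder _ _ _)); first by rewrite p0.
  rewrite mulrC -ler_pdivlMr//.
  have -> : e / 2 = ((e / 2) `^ p^-1) `^ p.
    by rewrite -powRrM mulVf ?gt_eqF// powRr1// divr_ge0// ltW.
  apply: ge0_ler_powR; rewrite ?nnegrE ?powR_ge0 ?(ltW p0)//.
  by near: x; apply: close; rewrite powR_gt0 ?divr_gt0.
have M0 : 0 < `|z| + 1 by rewrite ltr_wpDl.
have [C C0 lip] := spow_lipschitz (ltW p1) M0.
near=> x.
have xz1 : `|z - x| <= 1 by near: x; exact: close.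
apply: (le_trans (lip _ _ _ _)); first by rewrite lerDl.
  have -> : x = z - (z - x) by ring.
  by rewrite (le_trans (ler_normB _ _))// lerD2l.
rewrite mulrC -ler_pdivlMr//; near: x; apply: close; exact: divr_gt0.
Unshelve. all: by end_near. Qed.

Definition bipow al be a b z := a * spow z al + b * spow z be.

Lemma bipowN al be a b z : bipow al be a b (- z) = - bipow al be a b z.
Proof. by rewrite /bipow !spowN !mulrN opprD. Qed.

Section Bipow.
Variables (al be m : R).
Hypotheses (al0 : 0 < al) (al1 : al <= 1) (be1 : 1 <= be) (m0 : 0 < m).

Let be0 : 0 < be. Proof. exact: lt_le_trans be1. Qed.

(** The coefficients that rescaling can produce. Either one may be arbitrarily small, so lower
    bounds on [bipow] can only use [m <= a + b]. *)
Definition bicoef (a b : R) := [/\ 0 <= a <= 1, 0 <= b <= 1 & m <= a + b].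

Lemma bipow_le a b : bicoef a b -> {homo bipow al be a b : x y / x <= y}.
Proof.
case=> /andP[a0 _] /andP[b0 _] _ x y xy.
by apply: lerD; apply: ler_wpM2l => //; exact: spow_le.
Qed.

Lemma bipow_continuous a b : continuous (bipow al be a b).
Proof.
move=> z; apply: cvgD; apply: cvgM; try exact: cvg_cst; exact: spow_continuous.
Qed.

(** On [[0, 1]] the larger exponent gives the smaller power, which then carries the total weight
    [a + b]; beyond 1 the exponents exchange roles. *)
Lemma bipow_ge_small a b z : bicoef a b -> 0 <= z <= 1 ->
  m * z `^ be <= bipow al be a b z.
Proof.
case=> /andP[a0 _] /andP[b0 _] mab /andP[z0 z1].
have ze : 0 <= z `^ be by exact: powR_ge0.
rewrite /bipow !spow_ge0E ?gt_eqF// (@le_trans _ _ ((a + b) * z `^ be)) ?ler_wpM2r//.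
rewrite mulrDl lerD2r ler_wpM2l//.
move: z0; rewrite le_eqVlt => /orP[/eqP <-|z0]; first by rewrite !powR0 ?gt_eqF.
by rewrite ger_powR ?z0//; exact: le_trans be1.
Qed.

Lemma bipow_ge_large a b z : bicoef a b -> 1 <= z ->
  m * z `^ al <= bipow al be a b z.
Proof.
case=> /andP[a0 _] /andP[b0 _] mab z1.
have z0 : 0 <= z by exact: le_trans z1.
have ze : 0 <= z `^ al by exact: powR_ge0.
rewrite /bipow !spow_ge0E ?gt_eqF// (@le_trans _ _ ((a + b) * z `^ al)) ?ler_wpM2r//.
by rewrite mulrDl lerD2l ler_wpM2l// ler_powR//; exact: le_trans be1.
Qed.

(** On a bounded set the Lipschitz term is absorbed by [|x - y| <= (2 M)^(1 - al) |x - y|^al]. *)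
Lemma bipow_holder M : 0 < M -> exists2 K : R, 0 < K & forall a b, bicoef a b ->
  forall x y, `|x| <= M -> `|y| <= M ->
  `|bipow al be a b x - bipow al be a b y| <= K * `|x - y| `^ al.
Proof.
move=> M0; have [C C0 lip] := spow_lipschitz be1 M0.
exists (2 + C * (2 * M) `^ (1 - al)).
  by rewrite ltr_wpDr// mulr_ge0 ?powR_ge0 ?ltW.
move=> a b [/andP[a0 a1] /andP[b0 b1] _] x y xM yM.
have -> : bipow al be a b x - bipow al be a b y =
    a * (spow x al - spow y al) + b * (spow x be - spow y be).
  by rewrite /bipow; ring.
apply: (le_trans (ler_normD _ _)); rewrite mulrDl !normrM (ger0_norm a0) (ger0_norm b0).
apply: lerD.
  apply: (@le_trans _ _ (1 * `|spow x al - spow y al|)); first exact: ler_wpM2r.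
  by rewrite mul1r spow_holder ?al0.
apply: (@le_trans _ _ (1 * `|spow x be - spow y be|)); first exact: ler_wpM2r.
rewrite mul1r (le_trans (lip _ _ xM yM))// -mulrA ler_pM2l//.
have d2M : `|x - y| <= 2 * M by rewrite (le_trans (ler_normB _ _))//; lra.
rewrite -{1}(powRr1 (normr_ge0 (x - y))).
have -> : `|x - y| `^ 1 = `|x - y| `^ ((1 - al) + al) by rewrite subrK.
rewrite powRD; last first.
  by rewrite subrK oner_eq0.
by rewrite ler_wpM2r ?powR_ge0// ge0_ler_powR ?subr_ge0// nnegrE// mulr_ge0// ltW.
Qed.

(** [g] is the minimum over [[-M, M]] of a positive continuous function. *)
Lemma spow_increment p M d : 0 < p -> 0 <= M -> 0 < d -> exists2 g : R, 0 < g &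
  forall z, `|z| <= M -> spow z p + g <= spow (z + d) p.
Proof.
move=> p0 M0 d0; pose f z := spow (z + d) p - spow z p.
have cf : continuous f.
  move=> z; apply: cvgB; last exact: spow_continuous.
  apply: (@continuous_comp _ _ _ (fun z => z + d) (fun z => spow z p)).
    by apply: cvgD; [exact: cvg_id|exact: cvg_cst].
  exact: spow_continuous.
have [||c cM cmin] := @EVT_min R f (- M) M.
- by lra.
- exact: continuous_subspaceT.
exists (f c); first by rewrite subr_gt0 spow_lt// ltrDl.
move=> z zM; have := cmin z; rewrite in_itv /= -ler_norml => /(_ zM); rewrite /f; lra.
Qed.

Lemma bipow_increment M d : 0 <= M -> 0 < d -> exists2 g : R, 0 < g &
  forall a b, bicoef a b -> forall z, `|z| <= M ->
  bipow al be a b z + g <= bipow al be a b (z + d).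
Proof.
move=> M0 d0.
have [g1 g10 H1] := spow_increment al0 M0 d0.
have [g2 g20 H2] := spow_increment be0 M0 d0.
exists (m * Num.min g1 g2); first by rewrite mulr_gt0// lt_min g10.
move=> a b [/andP[a0 _] /andP[b0 _] mab] z zM; rewrite /bipow.
have := ler_wpM2l a0 (H1 z zM); have := ler_wpM2l b0 (H2 z zM).
have : 0 < Num.min g1 g2 by rewrite lt_min g10.
have i1 : Num.min g1 g2 <= g1 by rewrite ge_min lexx.
have i2 : Num.min g1 g2 <= g2 by rewrite ge_min lexx orbT.
move: (Num.min g1 g2) i1 i2 => g i1 i2 g0.
have := ler_wpM2r (ltW g0) mab; have := ler_wpM2l a0 i1; have := ler_wpM2l b0 i2.
lra.
Qed.

End Bipow.
End SignedPower.

(** * The contracting region of the scaled chain *)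

Section Barrier.
Variables (R : realType) (n : nat) (phi : nat -> R -> R).
Variables (u b1 M W : R) (k th gam cc Z : nat -> R).

(** The exponent is dictated by the Hölder exponent [(n - i) / (n.+1 - i)] of the functions used for
    [phi i]: it sends order [n.+1 - i] in [b] to order [n - i], that of the next level. *)
Definition level (i : nat) (b : R) : R := cc i * b ^+ (n.+1 - i).

(* The linear term makes the inverse of [phi i] Lipschitz at the chosen scale. *)
Definition tilt (i : nat) (z : R) : R := phi i z + th i * z.

(** This is [y i <= tilt^-1 (y i.+1) + E i], written without the inverse. *)
Definition upper_inside (E y : nat -> R) : Prop :=
  (forall i, (i < n)%N -> tilt i (y i - E i) <= y i.+1) /\ y n <= E n.

Definition inside (E y : nat -> R) : Prop :=
  upper_inside E y /\ upper_inside E (fun i => - y i).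

(** [Z] bounds the coordinates in the region, [bc_modulus] propagates the tolerances and
    [bc_increment] yields the inward speed at a face; [bc_th_level] and [bc_th_gam] make the tilt
    harmless to both. [bc_gain] compares, on face [i], the inward speed less the speed [n.+1] of the
    level, multiplied by the slope [th i], with the largest speed of the next coordinate. *)
Record barrier_constants : Prop := BarrierConstants {
  bc_phi_le : forall i, (i < n)%N -> {homo phi i : x y / x <= y};
  bc_phi_odd : forall i z, (i < n)%N -> phi i (- z) = - phi i z;
  bc_phi_cont : forall i, (i < n)%N -> continuous (phi i);
  bc_u : 0 < u;
  bc_b1 : 0 < b1 <= 1;
  bc_cc : forall i, (i <= n)%N -> 0 < cc i <= 1;
  bc_k : forall i, (i <= n)%N -> 0 < k i;
  bc_th : forall i, (i < n)%N -> 0 < th i;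
  bc_gam : forall i, (i < n)%N -> 0 < gam i;
  bc_Z : forall i, (i <= n)%N -> 1 <= Z i <= M - 2;
  bc_phi_Z : forall i z, (i < n)%N -> 0 <= z -> phi i z <= Z i.+1 -> z <= Z i - 1;
  bc_modulus : forall i b x y, (i < n)%N -> b1 <= b <= 1 -> `|x| <= M -> `|y| <= M ->
    `|x - y| <= 3 / 2 * level i b -> `|phi i x - phi i y| <= level i.+1 b / 4;
  bc_th_level : forall i, (i < n)%N -> th i * M <= level i.+1 b1 / 4;
  bc_th_gam : forall i, (i < n)%N -> th i * M <= gam i / 2;
  bc_increment : forall i z, (i < n)%N -> `|z| <= M ->
    phi i z + gam i <= phi i (z + level i b1 / 2);
  bc_W : 2 * M <= W;
  bc_gain : forall i, (i < n)%N ->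
    k i.+1 * W <= th i * (k i * (gam i / 4) - n.+1%:R)
}.

Hypothesis bc : barrier_constants.

Let u0 : 0 < u. Proof. exact: bc_u. Qed.

Lemma level_gt0 i b : (i <= n)%N -> b1 <= b -> 0 < level i b.
Proof.
move=> i_n bb; have [/andP[b10 _] /andP[c0 _]] := (bc_b1 bc, bc_cc bc i_n).
by rewrite mulr_gt0// exprn_gt0// (lt_le_trans b10).
Qed.

Lemma level_le1 i b : (i <= n)%N -> b1 <= b <= 1 -> level i b <= 1.
Proof.
move=> i_n /andP[bb b_1]; have [/andP[b10 _] /andP[c0 c1]] := (bc_b1 bc, bc_cc bc i_n).
have b0 : 0 < b by rewrite (lt_le_trans b10).
have b0' : 0 <= b by exact: ltW.
by apply: mulr_ile1 => //; [exact: ltW|exact: exprn_ge0|exact: exprn_ile1].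
Qed.

Lemma level_ge i b : (i <= n)%N -> b1 <= b -> level i b1 <= level i b.
Proof.
move=> i_n bb; have [/andP[b10 _] /andP[c0 c1]] := (bc_b1 bc, bc_cc bc i_n).
by rewrite ler_pM2l// lerXn2r ?nnegrE// ltW// (lt_le_trans b10).
Qed.

Lemma level_lipschitz i b b' : (i <= n)%N -> b1 <= b' -> b' <= b -> b <= 1 ->
  level i b - level i b' <= n.+1%:R * (b - b').
Proof.
move=> i_n bb' b'b b_1; have [/andP[b10 _] /andP[c0 c1]] := (bc_b1 bc, bc_cc bc i_n).
have powB p : b ^+ p - b' ^+ p <= p%:R * (b - b').
  elim: p => [|p IH]; first by rewrite !expr0 subrr mul0r.
  have bp0 : 0 <= b ^+ p by rewrite exprn_ge0//; lra.
  have bp1 : b ^+ p <= 1 by rewrite exprn_ile1//; lra.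
  have h1 : b' * (b ^+ p - b' ^+ p) <= b' * (p%:R * (b - b')).
    by rewrite ler_wpM2l//; lra.
  have h2 : b' * (p%:R * (b - b')) <= p%:R * (b - b').
    by rewrite ler_piMl ?mulr_ge0 ?ler0n ?subr_ge0//; lra.
  have h3 : b ^+ p * (b - b') <= b - b' by rewrite ler_piMl ?subr_ge0.
  rewrite !exprS -natr1; lra.
have p0 : 0 <= b ^+ (n.+1 - i) - b' ^+ (n.+1 - i).
  by rewrite subr_ge0 lerXn2r ?nnegrE//; lra.
rewrite /level -mulrBr (@le_trans _ _ (b ^+ (n.+1 - i) - b' ^+ (n.+1 - i))) ?ler_piMl//.
rewrite (le_trans (powB _))// ler_wpM2r ?subr_ge0// ler_nat.
exact: leq_subr.
Qed.

Lemma tilt_oddE i z : (i < n)%N -> tilt i (- z) = - tilt i z.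
Proof. by move=> i_n; rewrite /tilt (bc_phi_odd bc)// mulrN opprD. Qed.

Lemma tilt_decrease i x d : (i < n)%N -> 0 <= d -> tilt i (x - d) <= tilt i x - th i * d.
Proof.
move=> i_n d0; have := @bc_phi_le bc i i_n (x - d) x.
by rewrite /tilt; move=> H; have := H ltac:(lra); lra.
Qed.

Lemma tilt_le i : (i < n)%N -> {homo tilt i : x y / x <= y}.
Proof.
move=> i_n x y xy; have := @tilt_decrease i y (y - x) i_n; rewrite subKr.
have := bc_th bc i_n; rewrite subr_ge0 => th0 /(_ xy).
have : 0 <= th i * (y - x) by apply: mulr_ge0; [exact: ltW|rewrite subr_ge0].
lra.
Qed.

Lemma inside_opp E y : inside E y -> inside E (fun i => - y i).
Proof.
move=> [D1 D2]; split => //.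
by have -> : (fun i => - - y i) = y by apply/funext => i; rewrite opprK.
Qed.

Section Static.
Variables (b : R) (y s : nat -> R).
Hypotheses (bb : b1 <= b <= 1) (s0 : s 0%N = y 0%N).
Hypothesis (sS : forall i, (i < n)%N -> s i.+1 = phi i (s i)).
Let E i := level i b.

(** Descending induction from [Y n <= E n]; the unit in [bc_phi_Z] makes up for the tolerance
    [E i <= 1]. *)
Lemma upper_inside_bound (Y : nat -> R) : upper_inside E Y ->
  forall i, (i <= n)%N -> Y i <= Z i.
Proof.
move=> [Din Dn] i i_n.
have {i_n} : exists j, i = (n - j)%N by exists (n - i)%N; rewrite subKn.
move=> [j ->] {i}; elim: j => [|j IH].
  rewrite subn0 (le_trans Dn)// (le_trans (level_le1 _ bb))//.
  by have /andP[] := bc_Z bc (leqnn n).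
have [nj|jn] := leqP n j.
  have -> : (n - j.+1 = n - j)%N by lia.
  exact: IH.
set i := (n - j.+1)%N; have i_n : (i < n)%N by rewrite /i; lia.
have jS : (n - j)%N = i.+1 by rewrite /i; lia.
rewrite jS in IH.
have [Z1 ZM] := andP (bc_Z bc (ltnW i_n)).
have E1 : E i <= 1 by apply: level_le1 => //; exact: ltnW.
have [yE|yE] := leP (Y i - E i) 0; first by lra.
have := bc_phi_Z bc i_n (ltW yE); have := Din i i_n; rewrite /tilt.
have : 0 <= th i * (Y i - E i).
  by apply: mulr_ge0; apply: ltW => //; exact: bc_th.
move=> h1 h2 h3; have := h3 ltac:(lra); lra.
Qed.

Lemma inside_bound : inside E y -> forall i, (i <= n)%N -> `|y i| <= M - 2.
Proof.
move=> [D1 D2] i i_n; have /andP[_ ZM] := bc_Z bc i_n.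
rewrite ler_norml; have := upper_inside_bound D1 i_n.
by have := upper_inside_bound D2 i_n; lra.
Qed.

(** The points [y i - E i] and [y i + E i] are within [3/2 E i] of [s i], so [phi i] sends them
    within [E i.+1 / 4] of [s i.+1]. The tilt costs another quarter, and [y i.+1] lies between the
    tilted values, which reproduces the half. *)
Lemma inside_estimate : inside E y -> forall i, (i <= n)%N -> `|s i - y i| <= E i / 2.
Proof.
move=> D; have [[D1 _] [D2 _]] := D; elim=> [|i IH] i_n.
  rewrite s0 subrr normr0 divr_ge0// ltW// level_gt0//.
  by have /andP[] := bb.
have {}IH := IH (ltnW i_n); rewrite sS//.
have yM := inside_bound D (ltnW i_n).
have E0 : 0 < E i by apply: level_gt0; [exact: ltnW|have /andP[] := bb].
have E1 : E i <= 1 by apply: level_le1 => //; exact: ltnW.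
have ES : level i.+1 b1 <= E i.+1 by apply: level_ge => //; have /andP[] := bb.
have th0 := bc_th bc i_n; have thM := bc_th_level bc i_n.
have bnd x : `|x| <= M -> - (th i * M) <= th i * x /\ th i * x <= th i * M.
  rewrite ler_norml => /andP[x1 x2]; rewrite -mulrN !ler_pM2l//.
have mod x x' : `|x| <= M -> `|x'| <= M -> `|x - x'| <= 3 / 2 * E i ->
    `|phi i x - phi i x'| <= E i.+1 / 4 by exact: bc_modulus.
have sM : `|s i| <= M.
  have -> : s i = y i + (s i - y i) by ring.
  by rewrite (le_trans (ler_normD _ _))//; lra.
move: IH yM; rewrite !ler_norml => /andP[IH1 IH2] /andP[y1 y2].
have xM1 : `|y i - E i| <= M by rewrite ler_norml; apply/andP; split; lra.
have xM2 : `|y i + E i| <= M by rewrite ler_norml; apply/andP; split; lra.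
have := mod _ _ sM xM1; have := mod _ _ sM xM2.
have -> : `|s i - (y i + E i)| <= 3 / 2 * E i.
  by rewrite ler_norml; apply/andP; split; lra.
have -> : `|s i - (y i - E i)| <= 3 / 2 * E i.
  by rewrite ler_norml; apply/andP; split; lra.
move=> /(_ isT); rewrite ler_norml => /andP[m1 m2].
move=> /(_ isT); rewrite ler_norml => /andP[m3 m4].
have := D1 i i_n; have := D2 i i_n.
have -> : - y i - E i = - (y i + E i) by ring.
rewrite tilt_oddE// /tilt.
have [t1 t2] := bnd _ xM1; have [t3 t4] := bnd _ xM2.
move=> d2 d1; apply/andP; split; lra.
Qed.

Lemma inside_s_bound : inside E y -> forall i, (i <= n)%N -> `|s i| <= M - 3 / 2.
Proof.
move=> D i i_n; have := inside_estimate D i_n; have := inside_bound D i_n.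
have E1 : E i <= 1 by exact: level_le1.
move=> h1 h2; have -> : s i = y i + (s i - y i) by ring.
by rewrite (le_trans (ler_normD _ _))//; rewrite /E in E1 h2; lra.
Qed.

(** On the face [s i] exceeds [y i - E i] by at least [E i / 2], which is worth [gam i] after
    [phi i]; the tilt takes back at most half. *)
Lemma face_velocity i : inside E y -> (i < n)%N -> y i.+1 = tilt i (y i - E i) ->
  y i.+1 - s i.+1 <= - (gam i / 2).
Proof.
move=> D i_n yE; rewrite sS// yE /tilt.
have := inside_estimate D (ltnW i_n); have := inside_bound D (ltnW i_n).
have E1 : E i <= 1 by apply: level_le1 => //; exact: ltnW.
have Eb : level i b1 <= E i by apply: level_ge; [exact: ltnW|have /andP[] := bb].
have E0 : 0 < E i by apply: level_gt0; [exact: ltnW|have /andP[] := bb].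
rewrite ler_norml => /andP[y1 y2]; rewrite ler_norml => /andP[e1 e2].
have xM : `|y i - E i| <= M by rewrite ler_norml; apply/andP; split; lra.
have := bc_increment bc i_n xM.
have : phi i (y i - E i + level i b1 / 2) <= phi i (s i).
  by apply: (bc_phi_le bc i_n); lra.
have := bc_th_gam bc i_n.
have : th i * (y i - E i) <= th i * M.
  by rewrite ler_pM2l ?bc_th//; move: xM; rewrite ler_norml => /andP[].
lra.
Qed.

(** Here the argument of the discontinuous term stays away from zero, so this term pushes inwards
    with a known sign. *)
Lemma last_face_ge : inside E y -> y n = E n -> level n b1 / 2 <= s n.
Proof.
move=> D yE; have := inside_estimate D (leqnn n).
have := level_ge (leqnn n) (andP bb).1; rewrite ler_norml -/(E n) => h /andP[e1 _].
lra.
Qed.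

End Static.
End Barrier.

Lemma uniform_small (R : realType) (n : nat) (Q : nat -> R -> Prop) :
  (forall i, (i <= n)%N -> exists2 h, 0 < h & forall e, 0 < e <= h -> Q i e) ->
  exists2 h, 0 < h & forall i e, (i <= n)%N -> 0 < e <= h -> Q i e.
Proof.
elim: n => [|n IH] H.
  by have [h h0 hQ] := H 0%N isT; exists h => // i e; rewrite leqn0 => /eqP ->; exact: hQ.
have [|h h0 hQ] := IH; first by move=> i i_n; apply: H; exact: leqW.
have [h' h'0 hQ'] := H n.+1 (leqnn _).
exists (Num.min h h'); first by rewrite lt_min h0.
move=> i e + /andP[e0]; rewrite leq_eqVlt le_min => /orP[/eqP -> |i_n] /andP[eh eh'].
  by apply: hQ'; rewrite e0.
by apply: hQ; rewrite ?e0.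
Qed.

Lemma continuous_right_lt (R : realType) (f : R -> R) t c : continuous f -> f t < c ->
  exists2 h, 0 < h & forall r, t <= r < t + h -> f r < c.
Proof.
move=> cf ftc; have : \forall r \near t, f r < c by exact: (cvgr_lt (f t) (cf t)).
move=> /nbhs_ballP[h /= h0 hP]; exists h => // r /andP[tr rh]; apply: hP.
by rewrite /ball /= ltr_norml; apply/andP; split; lra.
Qed.

Lemma continuous_left_le0 (R : realType) (f : R -> R) t0 x : continuous f -> t0 < x ->
  (forall r, t0 <= r < x -> f r <= 0) -> f x <= 0.
Proof.
move=> cf t0x fle; rewrite leNgt; apply/negP => fx.
have : (\forall r \near x, 0 < f r) by exact: (cvgr_gt (f x) (cf x)).
move=> /nbhs_ballP[h /= h0 hP].
pose r := Num.max t0 (x - h / 2).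
have rx : r < x by rewrite gt_max t0x /=; lra.
have t0r : t0 <= r by rewrite le_max lexx.
have hr : x - h / 2 <= r by rewrite le_max lexx orbT.
have /hP : ball x h r by rewrite /ball /= ltr_norml; apply/andP; split; lra.
by rewrite ltNge fle// t0r.
Qed.

(** * Invariance of the shrinking region under the flow *)

Section BarrierFlow.
Variables (R : realType) (n : nat) (phi : nat -> R -> R).
Variables (u b1 M W G : R) (k th gam cc Z : nat -> R).
Hypothesis bc : barrier_constants n phi u b1 M W k th gam cc Z.
(** Per unit of [u], the inward speed on the last face is at least the speed at which the last level
    recedes. *)
Hypothesis gain_last : n.+1%:R <= k n * G.

Local Notation level := (level n cc).
Local Notation tilt := (tilt phi th).
Local Notation inside := (inside n phi th).
Local Notation upper_inside := (upper_inside n phi th).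

(* The differential equations enter only through increments over intervals, so
   that neither differentiability nor null sets are mentioned. *)
Record chain_flow (y s : nat -> R -> R) : Prop := ChainFlow {
  cf_cont : forall i, (i <= n)%N -> continuous (y i);
  cf_s0 : forall t, s 0%N t = y 0%N t;
  cf_sS : forall i t, (i < n)%N -> s i.+1 t = phi i (s i t);
  cf_ub : forall i t t' A, (i < n)%N -> 0 <= t -> t <= t' ->
    (forall r, t <= r <= t' -> u * k i * (y i.+1 r - s i.+1 r) <= A) ->
    y i t' - y i t <= A * (t' - t);
  cf_lb : forall i t t' A, (i < n)%N -> 0 <= t -> t <= t' ->
    (forall r, t <= r <= t' -> A <= u * k i * (y i.+1 r - s i.+1 r)) ->
    A * (t' - t) <= y i t' - y i t;
  cf_last_ub : forall t t', 0 <= t -> t <= t' ->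
    (forall r, t <= r <= t' -> level n b1 / 4 <= s n r) ->
    y n t' - y n t <= - (u * k n * G * (t' - t));
  cf_last_lb : forall t t', 0 <= t -> t <= t' ->
    (forall r, t <= r <= t' -> s n r <= - (level n b1 / 4)) ->
    u * k n * G * (t' - t) <= y n t' - y n t;
  cf_last_lip : forall t t', 0 <= t -> t <= t' ->
    (forall r, t <= r <= t' -> `|s n r| <= M) ->
    `|y n t' - y n t| <= u * k n * W * (t' - t)
}.

(** All nonlinearities are odd, so the lower faces of a chain are the upper faces of its
    opposite. *)
Lemma chain_flow_opp y s : chain_flow y s ->
  chain_flow (fun i t => - y i t) (fun i t => - s i t).
Proof.
case=> c s0 sS ub lb lub llb lip; split.
- by move=> i i_n x; apply: cvgN; exact: c.
- by move=> t; rewrite s0.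
- by move=> i t i_n; rewrite sS// (bc_phi_odd bc).
- move=> i t t' A i_n t0 tt' H.
  have := lb i t t' (- A) i_n t0 tt'; rewrite mulNr => L.
  suff : - (A * (t' - t)) <= y i t' - y i t by lra.
  by apply: L => r /H; lra.
- move=> i t t' A i_n t0 tt' H.
  have := ub i t t' (- A) i_n t0 tt'; rewrite mulNr => L.
  suff : y i t' - y i t <= - (A * (t' - t)) by lra.
  by apply: L => r /H; lra.
- move=> t t' t0 tt' H; have := llb t t' t0 tt' => L.
  by have := L ltac:(move=> r /H; lra); lra.
- move=> t t' t0 tt' H; have := lub t t' t0 tt' => L.
  by have := L ltac:(move=> r /H; lra); lra.
- move=> t t' t0 tt' H.
  have -> : - y n t' - - y n t = - (y n t' - y n t) by ring.
  by rewrite normrN; apply: lip => // r /H; rewrite normrN.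
Qed.

Section Step.
Variables (y s : nat -> R -> R) (bet : R -> R) (t : R).
Hypotheses (cf : chain_flow y s) (t0 : 0 <= t).
Hypotheses (betc : continuous bet) (bb : b1 <= bet t <= 1).
Hypothesis (bet_slope : forall r, t <= r -> bet t - u * (r - t) <= bet r <= bet t).
Hypothesis (D : inside (level^~ (bet t)) (y^~ t)).

Lemma s_continuous i : (i <= n)%N -> continuous (s i).
Proof.
elim: i => [|i IH] i_n.
  have -> : s 0%N = y 0%N by apply/funext => r; exact: (cf_s0 cf).
  exact: (cf_cont cf).
have -> : s i.+1 = phi i \o s i by apply/funext => r /=; rewrite (cf_sS cf).
move=> x; apply: continuous_comp; first by apply: IH; exact: ltnW.
exact: (bc_phi_cont bc).
Qed.

Lemma level_continuous i : continuous (fun r => level i (bet r)).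
Proof.
move=> x; apply: cvgM; first exact: cvg_cst.
apply: (@continuous_comp _ _ _ bet (fun z => z ^+ (n.+1 - i))); first exact: betc.
exact: exprn_continuous.
Qed.

Let u0 : 0 < u. Proof. exact: (bc_u bc). Qed.

Let bound_y i : (i <= n)%N -> `|y i t| <= M - 2.
Proof. exact: (inside_bound bc bb D). Qed.

Let bound_s i : (i <= n)%N -> `|s i t| <= M - 3 / 2.
Proof.
exact: (inside_s_bound (s := s^~ t) bc bb (cf_s0 cf t) (fun j jn => cf_sS cf t jn) D).
Qed.

Lemma speed_bound i : (i <= n)%N -> exists2 h, 0 < h & forall r, t <= r < t + h ->
  `|y i r - y i t| <= u * k i * W * (r - t).
Proof.
have WM := bc_W bc.
rewrite leq_eqVlt => /orP[/eqP ->|i_n].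
  have [||h h0 hP] := @continuous_right_lt R (fun r => `|s n r|) t M.
  - by move=> x; apply: cvg_norm; exact: s_continuous.
  - by have := bound_s (leqnn n); lra.
  exists h => // r /andP[tr rh]; apply: (cf_last_lip cf) => // r' /andP[tr' r'r].
  by apply/ltW/hP; rewrite tr' (le_lt_trans r'r).
have [||h h0 hP] := @continuous_right_lt R (fun r => `|y i.+1 r - s i.+1 r|) t W.
- by move=> x; apply: cvg_norm; apply: cvgB; [exact: (cf_cont cf)|exact: s_continuous].
- have := bound_s i_n; have := bound_y i_n.
  by have := ler_normB (y i.+1 t) (s i.+1 t); lra.
have uk0 : 0 < u * k i by rewrite mulr_gt0// (bc_k bc)// ltnW.
exists h => // r /andP[tr rh].
have {}hP r' : t <= r' <= r -> - W <= y i.+1 r' - s i.+1 r' <= W.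
  by move=> /andP[tr' r'r]; rewrite -ler_norml; apply/ltW/hP; rewrite tr' (le_lt_trans r'r).
rewrite ler_norml -mulNr; apply/andP; split.
  apply: (cf_lb cf) => // r' /hP /andP[h1 _].
  by rewrite -mulrN ler_pM2l.
apply: (cf_ub cf) => // r' /hP /andP[_ h1].
by rewrite ler_pM2l.
Qed.

(** Off the face continuity suffices. On it [y i] falls at speed at least [u k_i gam_i / 4] while
    the level falls at most at [u n.+1]; the slope [th i] turns the difference into a fall of the
    tilted value that outruns any fall of [y i.+1]. *)
Lemma face_step i : (i < n)%N -> exists2 h, 0 < h & forall r, t <= r < t + h ->
  b1 <= bet r -> tilt i (y i r - level i (bet r)) <= y i.+1 r.
Proof.
move=> i_n; have i_n' := ltnW i_n; have := D.1.1 i i_n; rewrite le_eqVlt => /orP[/eqP face|strict].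
  have vel : y i.+1 t - s i.+1 t < - (gam i / 4).
    have := face_velocity (s := s^~ t) bc bb (cf_s0 cf t)
      (fun j jn => cf_sS cf t jn) D i_n (esym face).
    by have := bc_gam bc i_n; lra.
  have [|h1 h10 hP] := @continuous_right_lt R (fun r => y i.+1 r - s i.+1 r) t _ _ vel.
    by move=> x; apply: cvgB; [exact: (cf_cont cf)|exact: s_continuous].
  have [h2 h20 sp] := speed_bound i_n.
  exists (Num.min h1 h2); first by rewrite lt_min h10.
  move=> r /andP[tr rh] br.
  have rh1 : r < t + h1.
    by rewrite (lt_le_trans rh)// lerD2l ge_min lexx.
  have rh2 : r < t + h2.
    by rewrite (lt_le_trans rh)// lerD2l ge_min lexx orbT.
  have uk0 : 0 < u * k i by rewrite mulr_gt0// (bc_k bc).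
  have fast : y i r - y i t <= - (u * k i * (gam i / 4)) * (r - t).
    apply: (cf_ub cf) => // r' /andP[tr' r'r]; rewrite -mulrN ler_pM2l//.
    by apply/ltW/hP; rewrite tr' (le_lt_trans r'r).
  have := sp r; rewrite tr rh2 => /(_ isT); rewrite ler_norml => /andP[slow _].
  have /andP[be1 be2] := bet_slope tr.
  have lev : level i (bet t) - level i (bet r) <= n.+1%:R * (u * (r - t)).
    apply: (le_trans (level_lipschitz bc i_n' br be2 (andP bb).2)).
    by rewrite ler_wpM2l//; lra.
  set d := u * (k i * (gam i / 4) - n.+1%:R) * (r - t).
  have gain := bc_gain bc i_n.
  have th0 := bc_th bc i_n.
  have kW : 0 <= k i.+1 * W.
    rewrite mulr_ge0 ?(ltW (bc_k bc _))//.
    have := bc_W bc; have /andP[Z1 Z2] := bc_Z bc (leqnn n); lra.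
  have d0 : 0 <= d.
    rewrite mulr_ge0 ?subr_ge0// mulr_ge0 ?(ltW u0)//.
    by rewrite -(pmulr_rge0 _ th0); lra.
  have step : y i r - level i (bet r) <= y i t - level i (bet t) - d.
    by rewrite /d; lra.
  apply: (le_trans (tilt_le bc i_n step)).
  apply: (le_trans (tilt_decrease bc _ i_n d0)).
  rewrite face.
  have : u * (k i.+1 * W) * (r - t) <= th i * d.
    have -> : th i * d = u * (th i * (k i * (gam i / 4) - n.+1%:R)) * (r - t).
      by rewrite /d; ring.
    by rewrite ler_wpM2r ?subr_ge0// ler_pM2l.
  lra.
have [||h h0 hP] := @continuous_right_lt R
    (fun r => tilt i (y i r - level i (bet r)) - y i.+1 r) t 0.
- move=> x; apply: cvgB; last exact: (cf_cont cf).
  have cyl : ((y i r - level i (bet r)) @[r --> x] --> y i x - level i (bet x))%classic.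
    by apply: cvgB; [exact: (cf_cont cf)|exact: level_continuous].
  apply: cvgD; last by apply: cvgM; [exact: cvg_cst|exact: cyl].
  apply: (@continuous_comp _ _ _ (fun r => y i r - level i (bet r)) (phi i)).
    exact: cyl.
  exact: (bc_phi_cont bc).
- by rewrite subr_lt0.
by exists h => // r /hP; rewrite subr_lt0 => /ltW.
Qed.

Lemma last_face_step : exists2 h, 0 < h & forall r, t <= r < t + h ->
  b1 <= bet r -> y n r <= level n (bet r).
Proof.
have := D.1.2; rewrite le_eqVlt => /orP[/eqP face|strict].
  have l0 : 0 < level n b1 by exact: (level_gt0 bc).
  have sn : - s n t < - (level n b1 / 4).
    have := last_face_ge (s := s^~ t) bc bb (cf_s0 cf t)
      (fun j jn => cf_sS cf t jn) D face.
    by lra.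
  have [|h h0 hP] := @continuous_right_lt R (fun r => - s n r) t _ _ sn.
    by move=> x; apply: cvgN; exact: s_continuous.
  exists h => // r /andP[tr rh] br.
  have fast : y n r - y n t <= - (u * k n * G * (r - t)).
    apply: (cf_last_ub cf) => // r' /andP[tr' r'r].
    by rewrite -lerN2; apply/ltW/hP; rewrite tr' (le_lt_trans r'r).
  have /andP[be1 be2] := bet_slope tr.
  have lev : level n (bet t) - level n (bet r) <= n.+1%:R * (u * (r - t)).
    apply: (le_trans (level_lipschitz bc (leqnn n) br be2 (andP bb).2)).
    by rewrite ler_wpM2l//; lra.
  have : n.+1%:R * (u * (r - t)) <= k n * G * (u * (r - t)).
    by rewrite ler_wpM2r// mulr_ge0 ?subr_ge0// ltW.
  lra.
have [||h h0 hP] := @continuous_right_lt R (fun r => y n r - level n (bet r)) t 0.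
- by move=> x; apply: cvgB; [exact: (cf_cont cf)|exact: level_continuous].
- by rewrite subr_lt0.
by exists h => // r /hP; rewrite subr_lt0 => /ltW.
Qed.

Lemma upper_inside_step : exists2 h, 0 < h & forall r, t <= r < t + h ->
  b1 <= bet r -> upper_inside (level^~ (bet r)) (y^~ r).
Proof.
have [i i_n|h h0 hP] := @uniform_small R n (fun i h => forall r, t <= r < t + h ->
    b1 <= bet r -> (i < n)%N -> tilt i (y i r - level i (bet r)) <= y i.+1 r).
  have [i_lt|n_le] := ltnP i n; last by exists 1.
  have [h h0 hP] := face_step i_lt; exists h => // e /andP[e0 eh] r /andP[tr re] br _.
  by apply: hP => //; rewrite tr (lt_le_trans re)// lerD2l.
have [h' h'0 hP'] := last_face_step.
exists (Num.min h h'); first by rewrite lt_min h0.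
move=> r /andP[tr rh] br; split.
  move=> i i_n; apply: (hP i (Num.min h h')) => //; first exact: ltnW.
    by rewrite lt_min h0 h'0 ge_min lexx.
  by rewrite tr.
by apply: hP' => //; rewrite tr (lt_le_trans rh)// lerD2l ge_min lexx orbT.
Qed.

End Step.

(** The region is closed, and from each of its points the flow stays inside for a short time of no
    controlled length; real induction joins the two. *)
Lemma inside_invariant y s (bet : R -> R) (t0 t1 : R) : chain_flow y s -> 0 <= t0 ->
  continuous bet -> (forall r, t0 <= r <= t1 -> b1 <= bet r <= 1) ->
  (forall r r', t0 <= r -> r <= r' -> bet r - u * (r' - r) <= bet r' <= bet r) ->
  inside (level^~ (bet t0)) (y^~ t0) ->
  forall r, t0 <= r <= t1 -> inside (level^~ (bet r)) (y^~ r).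
Proof.
move=> cf t00 betc bb slope D0; apply: real_induction => //.
- move=> x /andP[t0x xt1] Dx.
  have bx : b1 <= bet x <= 1 by apply: bb; rewrite t0x ltW.
  have {}Dx : inside (level^~ (bet x)) (y^~ x) by apply: Dx; rewrite t0x lexx.
  have x0 : 0 <= x by exact: le_trans t0x.
  have [h h0 hP] := upper_inside_step cf x0 betc bx (fun r => @slope x r t0x) Dx.
  have [h' h'0 hP'] := upper_inside_step (chain_flow_opp cf) x0 betc bx
    (fun r => @slope x r t0x) (inside_opp Dx).
  exists (Num.min h h'); first by rewrite lt_min h0.
  move=> r /andP[xr rh] rt1.
  have /andP[br _] : b1 <= bet r <= 1.
    by apply: bb; rewrite rt1 (le_trans t0x)// ltW.
  split.
    by apply: hP => //; rewrite ltW//= (lt_le_trans rh)// lerD2l ge_min lexx.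
  by apply: hP' => //; rewrite ltW//= (lt_le_trans rh)// lerD2l ge_min lexx orbT.
- move=> x /andP[t0x xt1] Dlt.
  have closed_upper Y S : chain_flow Y S ->
      (forall r, t0 <= r < x -> upper_inside (level^~ (bet r)) (Y^~ r)) ->
      upper_inside (level^~ (bet x)) (Y^~ x).
    move=> cY DY; split => [i i_n|]; rewrite -subr_le0.
      apply: (@continuous_left_le0 R
        (fun r => tilt i (Y i r - level i (bet r)) - Y i.+1 r) t0) => //.
        move=> z; apply: cvgB; last exact: (cf_cont cY).
        have cyl : ((Y i r - level i (bet r)) @[r --> z] --> Y i z - level i (bet z))%classic.
          by apply: cvgB; [exact: (cf_cont cY (ltnW i_n))|exact: level_continuous].
        apply: cvgD; last by apply: cvgM; [exact: cvg_cst|exact: cyl].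
        apply: (@continuous_comp _ _ _ (fun r => Y i r - level i (bet r)) (phi i)).
          exact: cyl.
        exact: (bc_phi_cont bc).
      by move=> r /DY[Di _]; rewrite subr_le0; exact: Di.
    apply: (@continuous_left_le0 R (fun r => Y n r - level n (bet r)) t0) => //.
      by move=> z; apply: cvgB; [exact: (cf_cont cY)|exact: level_continuous].
    by move=> r /DY[_ Dn]; rewrite subr_le0.
  split; first by apply: closed_upper cf _ => r /Dlt[].
  by apply: closed_upper (chain_flow_opp cf) _ => r /Dlt[].
Qed.

(** [bet] falls linearly from 1 to [b1] over all of [[t0, t]], which gives the conclusion at every
    late [t]; waiting [u^-1] keeps its slope below [u]. *)
Lemma inside_shrinks y s (t0 t : R) : chain_flow y s -> 0 <= t0 -> t0 + u^-1 <= t ->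
  inside (level^~ 1) (y^~ t0) -> inside (level^~ b1) (y^~ t).
Proof.
move=> cf t00 t0t D0.
have u0 : 0 < u by exact: (bc_u bc).
have ui0 : 0 < u^-1 by rewrite invr_gt0.
have dt0 : 0 < t - t0 by lra.
have /andP[b10 b11] := bc_b1 bc.
pose sl := (1 - b1) / (t - t0).
have sl0 : 0 <= sl by apply: divr_ge0; lra.
have slu : sl <= u.
  rewrite ler_pdivrMr//.
  have : u * u^-1 <= u * (t - t0) by rewrite ler_pM2l//; lra.
  by rewrite mulfV ?gt_eqF//; lra.
have sle : sl * (t - t0) = 1 - b1 by rewrite divfK// gt_eqF.
pose bet r := 1 - sl * (r - t0).
have -> : b1 = bet t by rewrite /bet sle; ring.
have bet1 : bet t0 = 1 by rewrite /bet subrr mulr0 subr0.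
apply: (@inside_invariant y s bet t0 t) => //.
- move=> x; apply: cvgB; first exact: cvg_cst.
  apply: cvgM; first exact: cvg_cst.
  by apply: cvgB; [exact: cvg_id|exact: cvg_cst].
- move=> r /andP[t0r rt]; rewrite /bet.
  have : sl * (r - t0) <= sl * (t - t0) by rewrite ler_wpM2l//; lra.
  have : 0 <= sl * (r - t0) by rewrite mulr_ge0 ?subr_ge0.
  by move=> *; apply/andP; split; lra.
- move=> r r' t0r rr'; rewrite /bet.
  have : sl * (r' - r) <= u * (r' - r) by rewrite ler_wpM2r ?subr_ge0.
  have : 0 <= sl * (r' - r) by rewrite mulr_ge0 ?subr_ge0.
  by move=> *; apply/andP; split; lra.
- by rewrite bet1.
- by rewrite lexx andbT; lra.
Qed.

End BarrierFlow.

(** Amplitudes, tolerances and gains are all chosen this way, each from the one with the next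
    index. *)
Lemma down_choice (T : Type) (P : nat -> T -> T -> Prop) (Q : T -> Prop) n v :
  Q v -> (forall i y, (i < n)%N -> Q y -> exists2 x, Q x & P i x y) ->
  exists f : nat -> T, [/\ f n = v, forall i, (i <= n)%N -> Q (f i) &
    forall i, (i < n)%N -> P i (f i) (f i.+1)].
Proof.
elim: n v => [|n IH] v Qv H; first by exists (fun=> v); split.
have [x Qx Px] := H n v (ltnSn n) Qv.
have [|f [fn fQ fP]] := IH x Qx; first by move=> i y i_n; apply: H; exact: ltnW.
exists (fun i => if (i <= n)%N then f i else v); split.
- by rewrite ltnn.
- by move=> i _; case: ifP => // /fQ.
- move=> i; rewrite ltnS => i_n; rewrite i_n; case: ltnP => [/fP//|n_i].
  have -> : i = n by apply/eqP; rewrite eqn_leq i_n.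
  by rewrite fn.
Qed.

(** * Choice of the gains *)

Section Gains.
Variables (R : realType) (n : nat) (al be : nat -> R) (m : R).
Hypotheses (al0 : forall i, (i < n)%N -> 0 < al i)
  (al1 : forall i, (i < n)%N -> al i <= 1)
  (alE : forall i, (i < n)%N -> (n.+1 - i)%:R * al i = (n - i)%:R :> R)
  (be1 : forall i, (i <= n)%N -> 1 <= be i)
  (m0 : 0 < m) (m1 : m <= 1).

(** The last equation is given for all thresholds [w] and bounds [B], because the relevant ones come
    from a region that is constructed later. *)
Record bichain (u : R) (k a b : nat -> R) (y s : nat -> R -> R) : Prop := Bichain {
  bch_coef : forall i, (i < n)%N -> bicoef m (a i) (b i);
  bch_cont : forall i, (i <= n)%N -> continuous (y i);
  bch_s0 : forall t, s 0%N t = y 0%N t;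
  bch_sS : forall i t, (i < n)%N -> s i.+1 t = bipow (al i) (be i) (a i) (b i) (s i t);
  bch_ub : forall i t t' A, (i < n)%N -> 0 <= t -> t <= t' ->
    (forall r, t <= r <= t' -> u * k i * (y i.+1 r - s i.+1 r) <= A) ->
    y i t' - y i t <= A * (t' - t);
  bch_lb : forall i t t' A, (i < n)%N -> 0 <= t -> t <= t' ->
    (forall r, t <= r <= t' -> A <= u * k i * (y i.+1 r - s i.+1 r)) ->
    A * (t' - t) <= y i t' - y i t;
  bch_last_ub : forall t t' w, 0 < w <= 1 -> 0 <= t -> t <= t' ->
    (forall r, t <= r <= t' -> w <= s n r) ->
    y n t' - y n t <= - (u * k n * (m * w `^ be n / 2) * (t' - t));
  bch_last_lb : forall t t' w, 0 < w <= 1 -> 0 <= t -> t <= t' ->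
    (forall r, t <= r <= t' -> s n r <= - w) ->
    u * k n * (m * w `^ be n / 2) * (t' - t) <= y n t' - y n t;
  bch_last_lip : forall t t' B, 0 <= B -> 0 <= t -> t <= t' ->
    (forall r, t <= r <= t' -> `|s n r| <= B) ->
    `|y n t' - y n t| <= u * k n * (2 + B `^ be n) * (t' - t)
}.

Let bcoef := bicoef m.
Let phi (a b : nat -> R) i := bipow (al i) (be i) (a i) (b i).
(** Beyond 1 [bipow] is at least [m z^al] for all coefficients, and [q] solves [m q^al = y]. Only
    indices below [n] occur, where [al i] is positive. *)
Lemma amplitude_bounds : exists Z : nat -> R,
  (forall i, (i <= n)%N -> 1 <= Z i) /\
  forall i, (i < n)%N -> forall a b z, bcoef a b -> 0 <= z ->
    bipow (al i) (be i) a b z <= Z i.+1 -> z <= Z i - 1.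
Proof.
have [||Z [_ ZQ ZP]] := @down_choice R (fun i x y => forall a b z, bcoef a b -> 0 <= z ->
    bipow (al i) (be i) a b z <= y -> z <= x - 1) (fun z => 1 <= z) n 1.
- by [].
- move=> i y i_n y1; set q := (y / m) `^ (al i)^-1.
  have ym : 1 <= y / m by rewrite ler_pdivlMr// mul1r (le_trans m1).
  have q1 : 1 <= q.
    by rewrite -(powRr0 (y / m)); apply: ler_powR => //; rewrite invr_ge0 ltW// al0.
  exists (1 + q); first by rewrite lerDl; lra.
  move=> a b z cab z0; apply: contraTT; rewrite -!ltNge => qz.
  have qz' : q < z by lra.
  have z1 : 1 <= z by lra.
  apply: lt_le_trans (bipow_ge_large (al0 i_n) (al1 i_n) (be1 (ltnW i_n)) cab z1).
  have -> : y = m * q `^ al i.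
      rewrite /q -powRrM mulVf ?gt_eqF ?al0// powRr1 ?(le_trans _ ym)//.
      by rewrite mulrC divfK// gt_eqF.
  by rewrite ltr_pM2l//; apply: gt0_ltr_powR; rewrite ?al0// ?nnegrE; lra.
by exists Z.
Qed.

(** The new constant [c] satisfies [K (3/2 c)^al <= c' / 4]. By [alE] the powers of [e] on both
    sides agree, so the choice does not depend on [e]. *)
Lemma level_hierarchy M : 0 < M -> exists cc : nat -> R,
  (forall i, (i <= n)%N -> 0 < cc i <= 1) /\
  forall i, (i < n)%N -> forall a b e x y, bcoef a b -> 0 < e <= 1 ->
    `|x| <= M -> `|y| <= M -> `|x - y| <= 3 / 2 * level n cc i e ->
    `|bipow (al i) (be i) a b x - bipow (al i) (be i) a b y| <= level n cc i.+1 e / 4.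
Proof.
move=> M0.
have [||cc [_ ccQ ccP]] := @down_choice R (fun i c c' => forall a b e x y, bcoef a b ->
    0 < e <= 1 -> `|x| <= M -> `|y| <= M -> `|x - y| <= 3 / 2 * (c * e ^+ (n.+1 - i)) ->
    `|bipow (al i) (be i) a b x - bipow (al i) (be i) a b y|
      <= (c' * e ^+ (n.+1 - i.+1)) / 4) (fun c => 0 < c <= 1) n 1.
- by rewrite ltr01 lexx.
- move=> i c' i_n /andP[c'0 _].
  have ai0 := al0 i_n.
  have [K K0 Kh] := bipow_holder m ai0 (al1 i_n) (be1 (ltnW i_n)) M0.
  set q := (c' / (4 * K)) `^ (al i)^-1.
  have q0 : 0 < q by rewrite powR_gt0// divr_gt0// mulr_gt0.
  exists (Num.min 1 (2 / 3 * q)).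
    by rewrite lt_min ltr01 mulr_gt0//= ge_min lexx.
  move=> a b e x y cab /andP[e0 e1] xM yM.
  set c := Num.min _ _ => dxy.
  have c0 : 0 <= c by rewrite le_min ler01 mulr_ge0// ltW.
  have cq : 3 / 2 * c <= q.
    have : c <= 2 / 3 * q by rewrite ge_min lexx orbT.
    lra.
  apply: (le_trans (Kh _ _ cab _ _ xM yM)).
  have ep0 p : 0 <= e ^+ p by rewrite exprn_ge0// ltW.
  have : `|x - y| `^ al i <= (q * e ^+ (n.+1 - i)) `^ al i.
    apply: ge0_ler_powR; rewrite ?nnegrE ?(ltW ai0)//.
      by rewrite mulr_ge0// ltW.
    by apply: (le_trans dxy); rewrite mulrA ler_wpM2r.
  rewrite powRM ?(ltW q0)// -powRrM mulVf ?gt_eqF// powRr1; last first.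
    by rewrite ltW// divr_gt0// mulr_gt0.
  rewrite -powR_mulrn ?(ltW e0)// -powRrM alE// powR_mulrn ?(ltW e0)// subSS.
  move=> /(ler_wpM2l (ltW K0)) /le_trans; apply.
  have -> : K * (c' / (4 * K) * e ^+ (n - i)) = c' * e ^+ (n - i) / 4.
    by field; rewrite gt_eqF.
  exact: lexx.
by exists cc; split.
Qed.

(** Subtracting [cc i] brings coordinate [i] below [- cc i / 2], where [bipow] is at most
    [- m (cc i / 2)^be <= - c]. The tilt has the same sign, so [c] can be fixed before [th]. *)
Lemma small_box (cc : nat -> R) : (forall i, (i <= n)%N -> 0 < cc i <= 1) ->
  exists2 c, 0 < c & forall a b th y, (forall i, (i < n)%N -> bcoef (a i) (b i)) ->
    (forall i, (i < n)%N -> 0 < th i) -> (forall i, (i <= n)%N -> `|y i| <= c) ->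
    inside n (phi a b) th (level n cc ^~ 1) y.
Proof.
move=> cc01.
have [|c c0 cP] := @uniform_small R n (fun i e =>
    e <= cc i / 2 /\ e <= m * (cc i / 2) `^ be i).
  move=> i i_n; have /andP[ci0 _] := cc01 i i_n.
  have p0 : 0 < m * (cc i / 2) `^ be i by rewrite mulr_gt0// powR_gt0// divr_gt0.
  exists (Num.min (cc i / 2) (m * (cc i / 2) `^ be i)).
    by rewrite lt_min p0 divr_gt0.
  by move=> e /andP[_]; rewrite le_min => /andP[].
exists c => // a b th y cab th0 yc.
have l1 i : level n cc i 1 = cc i by rewrite /level expr1n mulr1.
have {}cP i : (i <= n)%N -> c <= cc i / 2 /\ c <= m * (cc i / 2) `^ be i.
  by move=> i_n; apply: cP => //; rewrite c0 lexx.
have half Y : (forall i, (i <= n)%N -> - c <= Y i <= c) ->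
    upper_inside n (phi a b) th (level n cc ^~ 1) Y.
  move=> Yc; split => [i i_n|]; rewrite l1; last first.
    have [h _] := cP n (leqnn n); have /andP[_ h'] := Yc n (leqnn n).
    by have /andP[h'' _] := cc01 n (leqnn n); lra.
  have /andP[Y1 Y2] := Yc i (ltnW i_n); have /andP[Y3 Y4] := Yc _ i_n.
  have [c1 c2] := cP i (ltnW i_n); have /andP[ci0 ci1] := cc01 i (ltnW i_n).
  have le1 : Y i - cc i <= - (cc i / 2) by lra.
  have := bipow_le (al0 i_n) (be1 (ltnW i_n)) (cab i i_n) le1.
  rewrite bipowN /tilt /phi.
  have ci01 : 0 <= cc i / 2 <= 1 by lra.
  have := bipow_ge_small (al0 i_n) (al1 i_n) (be1 (ltnW i_n)) (cab i i_n) ci01.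
  have : th i * (Y i - cc i) <= 0 by rewrite pmulr_rle0 ?th0//; lra.
  lra.
split; apply: half => i i_n; first by rewrite -ler_norml yc.
by rewrite -ler_norml normrN yc.
Qed.

(** As the tolerances tend to zero the region collapses to the origin, uniformly in the
    coefficients; the sign of the tilt again makes [b1] independent of [th]. *)
Lemma final_level (cc : nat -> R) c' : 0 < c' -> (forall i, (i <= n)%N -> 0 < cc i <= 1) ->
  exists2 b1, 0 < b1 <= 1 & forall a b th y, (forall i, (i < n)%N -> bcoef (a i) (b i)) ->
    (forall i, (i < n)%N -> 0 < th i) ->
    inside n (phi a b) th (level n cc ^~ b1) y ->
    forall i, (i <= n)%N -> `|y i| <= c'.
Proof.
move=> c'0 cc01.
(* If coordinate [i] exceeded [eps i], its shifted value would be at least [eps i / 2], and [phi i]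
   would send it above [eps i.+1]. *)
pose eps : nat -> R := nat_rect (fun=> R) (Num.min 1 c')
  (fun i e => Num.min e (m * (e / 2) `^ be i / 2)).
have epsS i : eps i.+1 = Num.min (eps i) (m * (eps i / 2) `^ be i / 2) by [].
have eps0 i : 0 < eps i.
  elim: i => [|i IH]; first by rewrite lt_min ltr01.
  by rewrite epsS lt_min IH divr_gt0// mulr_gt0// powR_gt0// divr_gt0.
have epsle i : eps i <= Num.min 1 c'.
  by elim: i => [//|i IH]; rewrite epsS ge_min IH.
have eps1 i : eps i <= 1 by rewrite (le_trans (epsle i))// ge_min lexx.
have epsc i : eps i <= c' by rewrite (le_trans (epsle i))// ge_min lexx orbT.
have [|h h0 hP] := @uniform_small R n (fun i e => e <= eps i / 2).
  by move=> i _; exists (eps i / 2); [rewrite divr_gt0|move=> e /andP[]].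
pose b1 := Num.min 1 h.
have b10 : 0 < b1 by rewrite lt_min ltr01.
have b11 : b1 <= 1 by rewrite ge_min lexx.
have b1e i : (i <= n)%N -> b1 <= eps i / 2.
  by move=> i_n; apply: hP => //; rewrite b10 ge_min lexx orbT.
exists b1; first by rewrite b10.
move=> a b th y cab th0 [D1 D2].
have lev i : (i <= n)%N -> 0 <= level n cc i b1 <= b1.
  move=> i_n; have /andP[ci0 ci1] := cc01 i i_n.
  have p0 : 0 <= b1 ^+ (n - i) by rewrite exprn_ge0// ltW.
  have p1 : b1 ^+ (n - i) <= 1 by rewrite exprn_ile1// ltW.
  rewrite /level subSn// exprS; apply/andP; split.
    by rewrite mulr_ge0 ?mulr_ge0 ?(ltW ci0)// ltW.
  rewrite (@le_trans _ _ (b1 * b1 ^+ (n - i)))//.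
    by rewrite ler_piMl// mulr_ge0// ltW.
  by rewrite ler_piMr// ltW.
have half Y : upper_inside n (phi a b) th (level n cc ^~ b1) Y ->
    forall i, (i <= n)%N -> Y i <= eps i.
  move=> [Din Dn] i i_n.
  have {i_n} : exists j, i = (n - j)%N by exists (n - i)%N; rewrite subKn.
  move=> [j ->] {i}; elim: j => [|j IH].
    have /andP[_ l1] := lev n (leqnn n).
    by rewrite subn0; have := b1e n (leqnn n); have := eps0 n; lra.
  have [nj|jn] := leqP n j.
    have -> : (n - j.+1 = n - j)%N by lia.
    exact: IH.
  set i := (n - j.+1)%N; have i_n : (i < n)%N by rewrite /i; lia.
  have jS : (n - j)%N = i.+1 by rewrite /i; lia.
  rewrite jS in IH.
  have /andP[l0 l1] := lev i (ltnW i_n); have e0 := eps0 i.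
  have bi := b1e i (ltnW i_n).
  rewrite leNgt; apply/negP => Yi.
  have e2 : 0 <= eps i / 2 <= 1 by have := eps1 i; lra.
  have e3 : eps i / 2 <= Y i - level n cc i b1 by lra.
  have := bipow_le (al0 i_n) (be1 (ltnW i_n)) (cab i i_n) e3.
  have := bipow_ge_small (al0 i_n) (al1 i_n) (be1 (ltnW i_n)) (cab i i_n) e2.
  have := Din i i_n; rewrite /tilt /phi.
  have : 0 <= th i * (Y i - level n cc i b1).
    by apply: mulr_ge0; [exact/ltW/th0|lra].
  have : eps i.+1 <= m * (eps i / 2) `^ be i / 2.
    by rewrite epsS ge_min lexx orbT.
  have : 0 < m * (eps i / 2) `^ be i by rewrite mulr_gt0// powR_gt0// divr_gt0.
  lra.
move=> i i_n; rewrite ler_norml.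
by have := half _ D1 i i_n; have := half _ D2 i i_n; have := epsc i; lra.
Qed.

(** [Z], [M], [cc], [c] and [b1] depend only on the exponents and [m]; [gam] and [th] follow from
    [b1], and the gains come last. Since [u], [a] and [b] are quantified after the gains, one choice
    works at every scale. *)
Lemma contracting_gains (Kmin : R) : exists (k : nat -> R) (c : R),
  [/\ forall i, (i <= n)%N -> 1 <= k i, Kmin <= k n, 0 < c &
    forall u a b y s t0 t, 0 < u -> bichain u k a b y s -> 0 <= t0 -> t0 + u^-1 <= t ->
      (forall i, (i <= n)%N -> `|y i t0| <= c) ->
      forall i, (i <= n)%N -> `|y i t| <= c / 2 ^+ n.+1].
Proof.
have [Z [Z1 ZP]] := amplitude_bounds.
have [M ZM] : exists M, forall i, (i <= n)%N -> Z i <= M - 2.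
  exists (2 + \sum_(i < n.+1) Z i) => i i_n.
  rewrite addrAC subrr add0r (bigD1 (Ordinal (i_n : (i < n.+1)%N)))//= lerDl.
  by apply: sumr_ge0 => j _; rewrite (le_trans _ (Z1 j _))// -ltnS.
have M3 : 3 <= M by have := Z1 n (leqnn n); have := ZM n (leqnn n); lra.
have M0 : 0 < M by lra.
have [cc [cc01 ccP]] := level_hierarchy M0.
have [c c0 cP] := small_box cc01.
have [|b1 /andP[b10 b11] b1P] := @final_level cc (c / 2 ^+ n.+1) _ cc01.
  by rewrite divr_gt0// exprn_gt0.
have lev0 i : (i <= n)%N -> 0 < level n cc i b1.
  by move=> /cc01/andP[ci0 _]; rewrite mulr_gt0// exprn_gt0.
have [gam gamP] : exists gam : nat -> R, forall i, (i < n)%N -> 0 < gam i /\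
    forall a b, bcoef a b -> forall z, `|z| <= M ->
    bipow (al i) (be i) a b z + gam i <= bipow (al i) (be i) a b (z + level n cc i b1 / 2).
  suff /choice[g gP] : forall i, exists g, (i < n)%N -> 0 < g /\
      forall a b, bcoef a b -> forall z, `|z| <= M ->
      bipow (al i) (be i) a b z + g <= bipow (al i) (be i) a b (z + level n cc i b1 / 2).
    by exists g.
  move=> i; have [i_n|n_i] := ltnP i n; last by exists 0.
  have [|g g0 gP] := @bipow_increment R (al i) (be i) m (al0 i_n) (be1 (ltnW i_n)) m0
    M (level n cc i b1 / 2) (ltW M0).
    by rewrite divr_gt0// lev0// ltnW.
  by exists g.
pose th i := Num.min (level n cc i.+1 b1 / 4) (gam i / 2) / M.
have th0 i : (i < n)%N -> 0 < th i.
  by move=> i_n; rewrite divr_gt0// lt_min !divr_gt0 ?lev0// (gamP i i_n).1.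
have thM i : th i * M = Num.min (level n cc i.+1 b1 / 4) (gam i / 2).
  by rewrite divfK// gt_eqF.
(* [2 * M] bounds the differences [y i.+1 - s i.+1], the rest the speed in the last equation. *)
pose W := 2 * M + 2 + M `^ be n.
pose w := level n cc n b1 / 4.
have w0 : 0 < w by rewrite divr_gt0 ?lev0.
have w1 : w <= 1.
  have /andP[h1 h2] := cc01 n (leqnn n).
  have : level n cc n b1 <= 1.
    rewrite /level mulr_ile1 ?(ltW h1) ?exprn_ge0 ?(ltW b10)//.
    by rewrite exprn_ile1// ltW.
  by rewrite /w; lra.
pose G := m * w `^ be n / 2.
have G0 : 0 < G by rewrite divr_gt0// mulr_gt0// powR_gt0.
(* In the starting value [n.+1 / G] outruns the receding last level and [|Kmin|] is reserved for the
   perturbation. *)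
have [||k [kn k1 kP]] := @down_choice R (fun i x y =>
    y * W <= th i * (x * (gam i / 4) - n.+1%:R)) (fun x => 1 <= x) n
    (1 + `|Kmin| + n.+1%:R / G).
- by rewrite -addrA lerDl addr_ge0// divr_ge0// ltW.
- move=> i y i_n y1; have [g0 _] := gamP i i_n; have t0 := th0 i i_n.
  have W0 : 0 < W by rewrite ltr_wpDr ?powR_ge0//; lra.
  exists (1 + (y * W / th i + n.+1%:R) * (4 / gam i)).
    have yW : 0 <= y * W / th i.
      by apply: divr_ge0; [apply: mulr_ge0; lra|exact: ltW].
    by rewrite lerDl; apply: mulr_ge0; [rewrite addr_ge0|rewrite divr_ge0// ltW].
  have -> : th i * ((1 + (y * W / th i + n.+1%:R) * (4 / gam i)) * (gam i / 4) - n.+1%:R)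
      = th i * (gam i / 4) + y * W.
    by field; rewrite !gt_eqF.
  by rewrite lerDr; apply: mulr_ge0; [exact: ltW|rewrite divr_ge0// ltW].
exists k, c; split => //.
  rewrite kn (le_trans (ler_norm _))//.
  have : 0 <= n.+1%:R / G by rewrite divr_ge0// ltW.
  lra.
have k0 i : (i <= n)%N -> 0 < k i by move=> /k1; exact: lt_le_trans.
have gain : n.+1%:R <= k n * G.
  rewrite kn mulrDl divfK ?gt_eqF// lerDr.
  by apply: mulr_ge0; [exact: addr_ge0|exact: ltW].
move=> u a b y s t0 t u0 ch t00 tt yc.
have cab := bch_coef ch.
have bc : barrier_constants n (phi a b) u b1 M W k th gam cc Z.
  split => //.
  - by move=> i i_n; apply: (bipow_le (al0 i_n) (be1 (ltnW i_n)) (cab i i_n)).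
  - by move=> i z i_n; exact: bipowN.
  - by move=> i i_n; apply: bipow_continuous; [exact: al0|exact/be1/ltnW].
  - by rewrite b10.
  - by move=> i i_n; exact: (gamP i i_n).1.
  - by move=> i i_n; rewrite Z1//= ZM.
  - by move=> i z i_n; exact: ZP (cab i i_n).
  - move=> i e x z i_n /andP[be_ e1]; apply: ccP => //; first exact: cab.
    by rewrite e1 (lt_le_trans b10).
  - by move=> i i_n; rewrite thM ge_min lexx.
  - by move=> i i_n; rewrite thM ge_min lexx orbT.
  - by move=> i z i_n; exact: (gamP i i_n).2 (cab i i_n) z.
  - by rewrite /W; have := powR_ge0 M (be n); lra.
have cf : chain_flow n (phi a b) u b1 M W G k cc y s.
  case: ch => _ c1 c2 c3 c4 c5 c6 c7 c8; split => //.
  - by move=> t1 t2 t10 t12 H; apply: c6 => //; rewrite w0.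
  - by move=> t1 t2 t10 t12 H; apply: c7 => //; rewrite w0.
  - move=> t1 t2 t10 t12 H; apply: (le_trans (c8 _ _ _ (ltW M0) t10 t12 H)).
    rewrite ler_wpM2r ?subr_ge0// ler_wpM2l//.
      by rewrite mulr_ge0 ?(ltW u0)// ltW// k0.
    by rewrite /W; lra.
apply: (b1P a b th (y ^~ t)) => //.
apply: (inside_shrinks bc gain cf t00 tt).
exact: cP.
Qed.

End Gains.

(** * Scaling and fixed-time convergence of one chain *)

Section FixedTimeChain.
Variables (R : realType) (n : nat) (mu dinf : R).
Hypotheses (mu01 : 0 < mu < 1) (dinf0 : 0 < dinf) (dinf1 : n%:R * dinf < 1).

Local Notation N := n.+1.
Local Notation Phi := (PhiN mu (-1) dinf N).

(** Counted from 0, [al i] and [be i] are the exponents in the function of index [i.+1]. Here [al i]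
    is [(n - i) / (N - i)], which is 0 for [i = n]: that term is the sign. *)
Let al (i : nat) : R := rexp (-1) N i.+2 / rexp (-1) N i.+1.
Let be (i : nat) : R := rexp dinf N i.+2 / rexp dinf N i.+1.
Let m : R := Num.min mu (1 - mu).

(** The perturbation survives only in constants: it costs half of the switching term [mu] in the
    one-sided bounds and is absorbed by [2 * mu] in the last field. *)
Record recursive_chain (k : nat -> R) (x : nat -> R -> R) : Prop := RecursiveChain {
  rc_cont : forall i, (i <= n)%N -> continuous (x i);
  rc_ub : forall i t t' A, (i < n)%N -> 0 <= t -> t <= t' ->
    (forall r, t <= r <= t' -> k i * (x i.+1 r - Phi i.+1 (x 0%N r)) <= A) ->
    x i t' - x i t <= A * (t' - t);
  rc_lb : forall i t t' A, (i < n)%N -> 0 <= t -> t <= t' ->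
    (forall r, t <= r <= t' -> A <= k i * (x i.+1 r - Phi i.+1 (x 0%N r))) ->
    A * (t' - t) <= x i t' - x i t;
  rc_last_ub : forall t t' w, 0 < w -> 0 <= t -> t <= t' ->
    (forall r, t <= r <= t' -> w <= Phi n (x 0%N r)) ->
    x n t' - x n t <= - (k n * (mu / 2 + (1 - mu) * w `^ be n) * (t' - t));
  rc_last_lb : forall t t' w, 0 < w -> 0 <= t -> t <= t' ->
    (forall r, t <= r <= t' -> Phi n (x 0%N r) <= - w) ->
    k n * (mu / 2 + (1 - mu) * w `^ be n) * (t' - t) <= x n t' - x n t;
  rc_last_lip : forall t t' B, 0 <= B -> 0 <= t -> t <= t' ->
    (forall r, t <= r <= t' -> `|Phi n (x 0%N r)| <= B) ->
    `|x n t' - x n t| <= k n * (2 * mu + (1 - mu) * B `^ be n) * (t' - t)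
}.

Lemma rexpN1 i : (i <= N)%N -> rexp (-1) N i.+1 = (N - i)%:R :> R.
Proof. by move=> iN; rewrite /rexp natrB// -natr1; ring. Qed.

Lemma rexpE d i : rexp d N i.+1 = 1 - (n%:R - i%:R) * d :> R.
Proof. by rewrite /rexp -!natr1; ring. Qed.

Lemma rexp_gt0 i : 0 < rexp dinf N i.+1.
Proof.
rewrite rexpE; have : 0 <= i%:R * dinf by rewrite mulr_ge0// ltW.
by rewrite mulrBl; move: dinf1; lra.
Qed.

Lemma rexp_min i : rexp dinf N 1 <= rexp dinf N i.+1.
Proof.
rewrite !rexpE; have : 0 <= i%:R * dinf by rewrite mulr_ge0// ltW.
lra.
Qed.

Lemma rexp_step i : rexp dinf N i.+2 = rexp dinf N i.+1 + dinf.
Proof. by rewrite !rexpE -natr1; ring. Qed.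

Let al_ratio i : (i <= n)%N -> al i = (n - i)%:R / (N - i)%:R.
Proof. by move=> i_n; rewrite /al (@rexpN1 i.+1)// rexpN1 ?subSS// leqW. Qed.

Let alE i : (i <= n)%N -> (N - i)%:R * al i = (n - i)%:R :> R.
Proof.
move=> i_n; rewrite al_ratio// mulrC divfK// pnatr_eq0 subn_eq0.
by rewrite -ltnNge.
Qed.

Lemma sub_exponent_gt0 i : (i < n)%N ->
  0 < rexp (-1) N i.+2 / rexp (-1) N i.+1 :> R.
Proof.
move=> i_n; rewrite -/(al i) al_ratio 1?ltnW// divr_gt0// ltr0n subn_gt0//.
exact: ltnW.
Qed.

Let al_gt0 i (i_n : (i < n)%N) : 0 < al i := sub_exponent_gt0 i_n.

Let al_le1 i : (i <= n)%N -> al i <= 1.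
Proof.
move=> i_n; rewrite al_ratio// ler_pdivrMr ?mul1r ?ler_nat ?leq_sub2r//.
by rewrite ltr0n subn_gt0.
Qed.

Let al_last : al n = 0.
Proof. by rewrite al_ratio// subnn mul0r. Qed.

Lemma super_exponent_ge1 i : 1 <= rexp dinf N i.+2 / rexp dinf N i.+1.
Proof. by rewrite ler_pdivlMr ?rexp_gt0// mul1r (rexp_step i) lerDl ltW. Qed.

Let be_ge1 i : 1 <= be i := super_exponent_ge1 i.

Let m_gt0 : 0 < m.
Proof. by rewrite lt_min; have := mu01; lra. Qed.

Let m_le1 : m <= 1.
Proof. by rewrite ge_min; have := mu01; case: ltP => //; lra. Qed.

(* [u] is common to all [i]: this is where the homogeneity of the exponents is
   used. *)
Record scale (u : R) (rho : nat -> R) : Prop := Scale {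
  sc_u : 0 < u;
  sc_rho : forall i, 0 < rho i;
  sc_step : forall i, (i <= n)%N -> rho i.+1 = u * rho i;
  sc_last : 1 <= rho N;
  sc_al : forall i, (i <= n)%N -> rho i `^ al i <= rho i.+1;
  sc_be : forall i, (i <= n)%N -> rho i `^ be i <= rho i.+1;
  sc_tight : forall i, (i <= n)%N ->
    rho i `^ al i = rho i.+1 \/ rho i `^ be i = rho i.+1
}.

Let ca (rho : nat -> R) i := mu * (rho i `^ al i / rho i.+1).
Let cb (rho : nat -> R) i := (1 - mu) * (rho i `^ be i / rho i.+1).

(** [sc_tight] leaves one coefficient at its full value [mu] or [1 - mu], hence the bound [m]. *)
Lemma scale_coef u rho i : scale u rho -> (i <= n)%N ->
  bicoef m (ca rho i) (cb rho i).
Proof.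
move=> sc i_n; have /andP[mu0 mu1] := mu01; have r0 := sc_rho sc i.+1.
have frac p : rho i `^ p <= rho i.+1 -> 0 <= rho i `^ p / rho i.+1 <= 1.
  by move=> le_p; rewrite divr_ge0 ?powR_ge0 ?(ltW r0)//= ler_pdivrMr// mul1r.
have /andP[A0 A1] := frac _ (sc_al sc i_n); have /andP[B0 B1] := frac _ (sc_be sc i_n).
rewrite /ca /cb; split.
- by rewrite mulr_ge0 ?(ltW mu0)//= mulr_ile1// ltW.
- have c0 : 0 <= 1 - mu by lra.
  have c1 : 1 - mu <= 1 by lra.
  by rewrite mulr_ge0//= mulr_ile1.
- have muB : 0 <= mu * (rho i `^ al i / rho i.+1) by rewrite mulr_ge0// ltW.
  have muB' : 0 <= (1 - mu) * (rho i `^ be i / rho i.+1) by rewrite mulr_ge0//; lra.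
  have [e|e] := sc_tight sc i_n.
    rewrite e divff ?gt_eqF// mulr1 (@le_trans _ _ mu) ?ge_min ?lexx//; lra.
  rewrite e divff ?gt_eqF// mulr1 (@le_trans _ _ (1 - mu)) ?ge_min ?lexx ?orbT//; lra.
Qed.

(** [sc_step] extracts the same factor [u] from every equation. In the last one, [al n = 0] turns
    the constant [mu] into [ca rho n * rho N], and [1 <= rho N] keeps the bound [2 * mu] under
    control. *)
Lemma rescale_chain (u : R) (rho k : nat -> R) (x : nat -> R -> R) :
  scale u rho -> (forall i, (i <= n)%N -> 0 < k i) ->
  recursive_chain k x ->
  bichain n al be m u k (ca rho) (cb rho)
    (fun i t => x i t / rho i) (fun i t => Phi i (x 0%N t) / rho i).
Proof.
move=> sc k0 rc; have rho0 := sc_rho sc; have u0 := sc_u sc.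
have /andP[mu0 mu1] := mu01.
have rn0 i : rho i != 0 by rewrite gt_eqF.
have vel i z : (i <= n)%N -> u * k i * (z / rho i.+1) = k i * z / rho i.
  by move=> i_n; rewrite (sc_step sc i_n); field; rewrite rn0 gt_eqF.
have speed i A B (C : R) : (i <= n)%N -> A * rho i.+1 <= B -> 0 <= C ->
    u * k i * A * C <= k i * B * C / rho i.
  move=> i_n AB C0.
  have -> : k i * B * C / rho i = k i * B / rho i * C by ring.
  rewrite ler_wpM2r// -vel// ler_pM2l ?mulr_gt0 ?k0//.
  by rewrite ler_pdivlMr.
have diff i t t' : x i t' / rho i - x i t / rho i = (x i t' - x i t) / rho i by ring.
have cab := scale_coef sc (leqnn n).
have be0 : 0 < be n by exact: lt_le_trans (be_ge1 n).
have powM (w : R) : 0 <= w -> (1 - mu) * (w * rho n) `^ be n = cb rho n * w `^ be n * rho N.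
  by move=> w0; rewrite /cb powRM ?(ltW (rho0 _))//; field; rewrite rn0.
have lastA : ca rho n * rho N = mu.
  by rewrite /ca al_last powRr0; field; rewrite rn0.
have last (w : R) : 0 < w <= 1 ->
    m * w `^ be n / 2 * rho N <= mu / 2 + (1 - mu) * (w * rho n) `^ be n.
  move=> /andP[w0 w1]; rewrite powM ?(ltW w0)// -lastA.
  case: cab => /andP[a0 a1] /andP[b0 b1] mab.
  have p0 : 0 <= w `^ be n by exact: powR_ge0.
  have p1 : w `^ be n <= 1
    by apply: le_trans (_ : w <= 1) => //; apply: ge1r_powR; [rewrite w0|exact: be_ge1].
  have -> : ca rho n * rho N / 2 + cb rho n * w `^ be n * rho N =
     (ca rho n / 2 + cb rho n * w `^ be n) * rho N by field.
  rewrite ler_wpM2r ?(ltW (rho0 _))//.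
  have := ler_wpM2r p0 mab.
  have : ca rho n * w `^ be n <= ca rho n by rewrite ler_piMr.
  have : 0 <= cb rho n * w `^ be n by rewrite mulr_ge0.
  lra.
split.
- by move=> i i_n; exact: scale_coef sc (ltnW i_n).
- by move=> i i_n t; apply: cvgM; [exact: (rc_cont rc)|exact: cvg_cst].
- by [].
- move=> i t i_n /=; rewrite -[RHS]/(_ * _ + _ * _) /=.
  set z := Phi i (x 0%N t).
  have -> : phiN mu (-1) dinf N i.+1 z =
      mu * spow (rho i * (z / rho i)) (al i) + (1 - mu) * spow (rho i * (z / rho i)) (be i).
    by rewrite [rho i * _]mulrC divfK.
  move: (z / rho i) => {}z.
  by rewrite !spowMl// /ca /cb; field; rewrite rn0.
- move=> i t t' A i_n t0 tt' H; rewrite diff ler_pdivrMr//.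
  have -> : A * (t' - t) * rho i = A * rho i * (t' - t) by ring.
  apply: (rc_ub rc) => // r /H; rewrite -mulrBl vel 1?ltnW//.
  by rewrite ler_pdivrMr.
- move=> i t t' A i_n t0 tt' H; rewrite diff ler_pdivlMr//.
  have -> : A * (t' - t) * rho i = A * rho i * (t' - t) by ring.
  apply: (rc_lb rc) => // r /H; rewrite -mulrBl vel 1?ltnW//.
  by rewrite ler_pdivlMr.
- move=> t t' w w01 t0 tt' H; rewrite diff ler_pdivrMr//.
  have /andP[w0 _] := w01.
  have wr0 : 0 < w * rho n by rewrite mulr_gt0.
  have tt0 : 0 <= t' - t by rewrite subr_ge0.
  apply: (le_trans (rc_last_ub rc wr0 t0 tt' _)).
    by move=> r /H; rewrite ler_pdivlMr.
  rewrite mulNr lerN2 -ler_pdivlMr//.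
  exact: speed (last w w01) tt0.
- move=> t t' w w01 t0 tt' H; rewrite diff ler_pdivlMr//.
  have /andP[w0 _] := w01.
  have wr0 : 0 < w * rho n by rewrite mulr_gt0.
  have tt0 : 0 <= t' - t by rewrite subr_ge0.
  apply: le_trans (rc_last_lb rc wr0 t0 tt' _).
    rewrite -ler_pdivlMr//; exact: speed (last w w01) tt0.
  by move=> r /H; rewrite ler_pdivrMr// mulNr.
- move=> t t' B B0 t0 tt' H.
  rewrite diff normrM [X in _ * X]gtr0_norm ?invr_gt0// ler_pdivrMr//.
  have Br0 : 0 <= B * rho n by rewrite mulr_ge0// ltW.
  apply: (le_trans (rc_last_lip rc Br0 t0 tt' _)).
    move=> r /H; rewrite normrM [X in _ * X]gtr0_norm ?invr_gt0//.
    by rewrite ler_pdivrMr.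
  have -> : u * k n * (2 + B `^ be n) * (t' - t) * rho n =
      k n * ((2 + B `^ be n) * rho N) * (t' - t).
    by rewrite (sc_step sc (leqnn n)); ring.
  rewrite ler_wpM2r ?subr_ge0// ler_pM2l ?k0// powM// [(2 + _) * _]mulrDl lerD//.
    have := sc_last sc; lra.
  rewrite ler_wpM2r ?(ltW (rho0 _))// ler_piMl ?powR_ge0//.
  by case: cab => _ /andP[].
Qed.

(** The weights at infinity for [R = 2^j]; [slow_size] uses those at zero, the naturals [N - i], for
    [R = 2^-j]. *)
Definition fast_size (j i : nat) : R := (2 ^+ j) `^ rexp dinf N i.+1.
Definition slow_size (j i : nat) : R := (2 ^- j) ^+ (N - i).

Lemma fast_scale j : scale ((2 ^+ j) `^ dinf) (fast_size j).
Proof.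
have R1 : 1 <= 2 ^+ j :> R by rewrite exprn_ege1// ler1n.
have R0 : 0 < 2 ^+ j :> R by exact: lt_le_trans R1.
have tight i : fast_size j i `^ be i = fast_size j i.+1.
  by rewrite /fast_size -powRrM /be mulrC divfK// gt_eqF// rexp_gt0.
have size1 i : 1 <= fast_size j i.
  by rewrite -(powRr0 (2 ^+ j)) ler_powR// ltW// rexp_gt0.
split.
- by rewrite powR_gt0.
- by move=> i; rewrite powR_gt0.
- move=> i i_n; rewrite /fast_size rexp_step powRD 1?mulrC//.
  by rewrite (lt0r_neq0 R0) implybT.
- by [].
- move=> i i_n; rewrite -tight ler_powR//.
  exact: le_trans (al_le1 i_n) (be_ge1 i).
- by move=> i i_n; rewrite tight.
- by move=> i i_n; right.
Qed.

Lemma slow_scale j : scale (2 ^+ j) (slow_size j).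
Proof.
have R0 : 0 < 2 ^- j :> R by rewrite invr_gt0 exprn_gt0.
have R1 : 2 ^- j <= 1 :> R by rewrite invf_le1 ?exprn_gt0// exprn_ege1// ler1n.
have tight i : (i <= n)%N -> slow_size j i `^ al i = slow_size j i.+1.
  move=> i_n; rewrite /slow_size -powR_mulrn ?(ltW R0)// -powRrM alE//.
  by rewrite powR_mulrn ?(ltW R0)// subSS.
have size0 i : 0 < slow_size j i by rewrite exprn_gt0.
split => //.
- move=> i i_n; rewrite /slow_size subSS subSn// exprS mulrA divff ?mul1r//.
- by rewrite /slow_size subnn expr0.
- by move=> i i_n; rewrite tight.
- move=> i i_n; rewrite -tight// ger_powR//.
    by rewrite size0 /slow_size exprn_ile1// ltW.
  exact: le_trans (al_le1 i_n) (be_ge1 i).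
- by move=> i i_n; left; exact: tight.
Qed.

(** The time [1 / u] spent at [R = 2^j] is [q^j]. *)
Let q : R := 2 `^ (- dinf).

Let q_gt0 : 0 < q. Proof. by rewrite powR_gt0. Qed.

Let q_lt1 : q < 1.
Proof.
rewrite /q powRN invf_lt1 ?powR_gt0//.
have : 1 `^ dinf < 2 `^ dinf by apply: gt0_ltr_powR; rewrite ?nnegrE ?ltr1n.
by rewrite powR1.
Qed.

Theorem recursive_chain_fixed_time (Kmin : R) : exists (k : nat -> R) (T : R),
  [/\ forall i, (i <= n)%N -> 1 <= k i, Kmin <= k n, 0 < T &
    forall x, recursive_chain k x ->
      forall t, T <= t -> forall i, (i <= n)%N -> x i t = 0].
Proof.
have [k [c [k1 kK c0 contract]]] := @contracting_gains R n al be m al_gt0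
  (fun i i_n => al_le1 (ltnW i_n)) (fun i i_n => alE (ltnW i_n))
  (fun i _ => be_ge1 i) m_gt0 m_le1 Kmin.
have k0 i : (i <= n)%N -> 0 < k i by move=> /k1; exact: lt_le_trans.
have q1 : 0 < 1 - q by rewrite subr_gt0.
(* The first term bounds the sum of [q^j] over [j >= 1], the second that of [2^-j] over [j >= 0]. *)
exists k, ((1 - q)^-1 + 2); split => //; first by rewrite addr_gt0// invr_gt0.
move=> x rc.
have shrink u rho t0 t : scale u rho -> 0 <= t0 -> t0 + u^-1 <= t ->
    (forall i, (i <= n)%N -> `|x i t0| <= c * rho i) ->
    forall i, (i <= n)%N -> `|x i t| <= c * rho i / 2 ^+ N.
  move=> sc t00 t0t xc i i_n.
  have nrm j r : `|x j r / rho j| = `|x j r| / rho j.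
    by rewrite normrM [X in _ * X]gtr0_norm// invr_gt0 (sc_rho sc).
  have := contract u _ _ _ _ t0 t (sc_u sc) (rescale_chain sc k0 rc) t00 t0t.
  have H j : (j <= n)%N -> `|x j t0 / rho j| <= c.
    by move=> j_n; rewrite nrm ler_pdivrMr ?(sc_rho sc)// xc.
  move=> /(_ H i i_n); rewrite nrm ler_pdivrMr ?(sc_rho sc)// => /le_trans; apply.
  by rewrite mulrAC.
have pow2 : 0 < 2 ^+ N :> R by rewrite exprn_gt0.
(* The condition [0 < j] matters: the hypothesis concerns the instant [t0], the conclusion all late
   times, and only a contraction passes from one to the other. *)
have fast j t0 : 0 <= t0 -> (forall i, (i <= n)%N -> `|x i t0| <= c * fast_size j i) ->
    forall t, t0 + \sum_(l < j) q ^+ l.+1 <= t ->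
    (0 < j)%N -> forall i, (i <= n)%N -> `|x i t| <= c.
  elim: j t0 => [//|j IH] t0 t00 xj t t0t _ i i_n.
  rewrite big_ord_recr /= in t0t.
  have uE J : ((2 ^+ J) `^ dinf)^-1 = q ^+ J :> R.
    rewrite -(powR_mulrn J (ler0n R 2)) -powRrM -powRN mulrC -mulNr powRrM.
    by rewrite powR_mulrn ?powR_ge0.
  have step r : t0 + q ^+ j.+1 <= r ->
      forall i', (i' <= n)%N -> `|x i' r| <= c * fast_size j i'.
    move=> t0r i' i'_n; rewrite -uE in t0r.
    apply: (le_trans (shrink _ _ _ _ (fast_scale j.+1) t00 t0r xj i' i'_n)).
    rewrite -mulrA ler_pM2l// ler_pdivrMr// /fast_size exprS powRM ?exprn_ge0//.
    rewrite mulrC ler_wpM2l ?powR_ge0//.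
    rewrite -(powRr1 (ler0n R 2)) -powR_mulrn ?powR_ge0// -powRrM mul1r powRr1//.
    rewrite ler_powR ?ler1n//.
    have i'N : i'%:R <= n%:R :> R by rewrite ler_nat.
    have : 0 <= (n%:R - i'%:R) * dinf by rewrite mulr_ge0 ?subr_ge0// ltW.
    have : 1 <= N%:R :> R by rewrite ler1n.
    by rewrite rexpE; lra.
  have sum0 : 0 <= \sum_(l < j) q ^+ l.+1.
    by apply: sumr_ge0 => l _; rewrite exprn_ge0// ltW.
  case: j IH step sum0 t0t {xj uE} => [|j] IH step sum0 t0t.
    have := step t _ i i_n; rewrite /fast_size expr0 powR1 mulr1; apply.
    by lra.
  apply: (IH (t0 + q ^+ j.+2)) => //.
  - by rewrite addr_ge0// exprn_ge0// ltW.
  - by apply: step.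
  - by lra.
(* Each contraction is started at [t - 2^-j], where the previous bound already holds, so every late
   [t] is covered. *)
have slow t1 : 0 <= t1 -> (forall t, t1 <= t -> forall i, (i <= n)%N -> `|x i t| <= c) ->
    forall j t, t1 + \sum_(l < j) 2 ^- l <= t ->
    forall i, (i <= n)%N -> `|x i t| <= c * slow_size j i.
  move=> t10 xc; elim=> [|j IH] t.
    by rewrite big_ord0 addr0 => /xc H i /H; rewrite /slow_size expr0 invr1 expr1n mulr1.
  rewrite big_ord_recr /= => t1t i i_n.
  have sum0 : 0 <= \sum_(l < j) 2 ^- l :> R.
    by apply: sumr_ge0 => l _; rewrite invr_ge0 exprn_ge0.
  have [t'0 t't] : 0 <= t - 2 ^- j /\ t - 2 ^- j + 2 ^- j <= t by split; lra.
  have xj i' : (i' <= n)%N -> `|x i' (t - 2 ^- j)| <= c * slow_size j i'.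
    by apply: IH; lra.
  apply: (le_trans (shrink _ _ _ _ (slow_scale j) t'0 t't xj i i_n)).
  have -> : slow_size j.+1 i = slow_size j i * 2 ^- (N - i).
    by rewrite /slow_size exprSr invfM exprMn (exprVn (2 : R)).
  rewrite -mulrA ler_pM2l// ler_pM2l ?(sc_rho (slow_scale j))//.
  by rewrite lef_pV2 ?posrE ?exprn_gt0// ler_eXn2l ?ltr1n// leq_subr.
have [j [j0 xj]] : exists j, (0 < j)%N /\
    forall i, (i <= n)%N -> `|x i 0| <= c * fast_size j i.
  pose X := \sum_(i < N) `|x i 0|.
  have X0 : 0 <= X by apply: sumr_ge0.
  have r0 := rexp_gt0 0.
  (* [c Y^r = X] for the smallest weight [r], so any [2^j] above both 1 and [Y] gives a box
     containing all initial values. The successor in the witness makes [j] positive. *)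
  pose Y := (X / c) `^ (rexp dinf N 1)^-1.
  have Y0 : 0 <= Y by exact: powR_ge0.
  exists (Num.bound Y).+1; split => // i i_n.
  have YR : Y <= 2 ^+ (Num.bound Y).+1.
    rewrite (le_trans (ltW (archi_boundP Y0)))// -natrX ler_nat.
    by rewrite (leq_trans (leqnSn _))// ltnW// ltn_expl.
  have R1 : 1 <= 2 ^+ (Num.bound Y).+1 :> R by rewrite exprn_ege1// ler1n.
  have -> : `|x i 0| = c * (`|x i 0| / c) by rewrite mulrC divfK// gt_eqF.
  rewrite ler_pM2l// /fast_size.
  apply: (@le_trans _ _ (X / c)).
    rewrite ler_wpM2r ?invr_ge0 ?(ltW c0)// /X.
    by rewrite (bigD1 (Ordinal (i_n : (i < N)%N)))//= lerDl sumr_ge0.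
  apply: (@le_trans _ _ (Y `^ rexp dinf N 1)).
    by rewrite -powRrM mulVf ?gt_eqF// powRr1// divr_ge0// ltW.
  apply: (@le_trans _ _ ((2 ^+ (Num.bound Y).+1) `^ rexp dinf N 1)).
    by apply: ge0_ler_powR; rewrite ?nnegrE ?(ltW r0) ?exprn_ge0.
  by apply: ler_powR => //; exact: rexp_min.
have sumq l : \sum_(j < l) q ^+ j.+1 <= (1 - q)^-1.
  rewrite -[leRHS]mul1r ler_pdivlMr//.
  suff -> : (\sum_(j < l) q ^+ j.+1) * (1 - q) = q - q ^+ l.+1.
    have : 0 <= q ^+ l.+1 by rewrite exprn_ge0// ltW.
    by have := q_lt1; lra.
  elim: l => [|l IH]; first by rewrite big_ord0 mul0r expr1 subrr.
  by rewrite big_ord_recr /= mulrDl IH [q ^+ l.+2]exprSr; ring.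
have sum2 l : \sum_(j < l) 2 ^- j <= 2 :> R.
  suff -> : \sum_(j < l) 2 ^- j = 2 - 2 * 2 ^- l :> R.
    by rewrite lerBlDr lerDl mulr_ge0// invr_ge0 exprn_ge0.
  elim: l => [|l IH]; first by rewrite big_ord0 expr0 invr1 mulr1 subrr.
  by rewrite big_ord_recr /= IH exprS invfM; field; rewrite expf_neq0.
have box t : (1 - q)^-1 <= t -> forall i, (i <= n)%N -> `|x i t| <= c.
  by move=> qt; apply: (fast j 0) => //; rewrite add0r (le_trans (sumq j)).
have q1V : 0 <= (1 - q)^-1 by rewrite invr_ge0 ltW.
move=> t Tt i i_n; apply/eqP; rewrite -normr_le0 leNgt; apply/negP => x0.
(* The bounds [c * slow_size l i] hold for all [l] from the same time on, and they tend to zero. *)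
pose l := Num.bound (c / `|x i t|).
have xl : `|x i t| <= c * slow_size l i.
  apply: (slow _ q1V box l) => //; apply: le_trans Tt.
  by rewrite lerD2l.
have sl : slow_size l i <= 2 ^- l.
  rewrite /slow_size subSn// exprS ler_piMr ?invr_ge0 ?exprn_ge0//.
  by rewrite exprn_ile1// ?invr_ge0 ?exprn_ge0// invf_le1 ?exprn_gt0// exprn_ege1// ler1n.
have : c / `|x i t| < 2 ^+ l.
  apply: (lt_trans (archi_boundP _)); first by rewrite divr_ge0// ltW.
  by rewrite -natrX ltr_nat ltn_expl.
rewrite ltr_pdivrMr// mulrC -ltr_pdivrMr ?exprn_gt0// ltNge => /negP; apply.
by apply: (le_trans xl); rewrite ler_pM2l.
Qed.

End FixedTimeChain.

(** * Error chains with a bounded perturbation *)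

Section ErrorChain.
Variable R : realType.

Lemma abs_cont_sub (a b a' b' : R) f : a <= a' -> b' <= b ->
  abs_cont a b f -> abs_cont a' b' f.
Proof.
move=> aa' b'b acf e /acf[d d0 dP]; exists d => // m s t st; apply: dP => i.
by have [s1 [s2 s3]] := st i; split; [exact: le_trans s1|split => //; exact: le_trans b'b].
Qed.

Lemma abs_contB (a b : R) f g :
  abs_cont a b f -> abs_cont a b g -> abs_cont a b (fun t => f t - g t).
Proof.
move=> acf acg e e0.
have [d d0 dP] := acf _ (divr_gt0 e0 (ltr0n _ 2)).
have [d' d'0 dP'] := acg _ (divr_gt0 e0 (ltr0n _ 2)).
exists (Num.min d d'); first by rewrite lt_min d0.
move=> m s t st disj; rewrite lt_min => /andP[sd sd'].
have := ltrD (dP m s t st disj sd) (dP' m s t st disj sd').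
have -> : e / 2 + e / 2 = e by lra.
apply: le_lt_trans; rewrite -big_split; apply: ler_sum => i _ /=.
have -> : f (t i) - g (t i) - (f (s i) - g (s i)) =
  (f (t i) - f (s i)) - (g (t i) - g (s i)) by ring.
exact: ler_normB.
Qed.

Lemma abs_cont_unif (a b : R) f e : abs_cont a b f -> 0 < e ->
  exists2 d : R, 0 < d & forall s t, a <= s <= b -> a <= t <= b ->
    `|t - s| < d -> `|f t - f s| < e.
Proof.
move=> acf e0; have [d d0 dP] := acf e e0; exists d => //.
have inc s t : a <= s -> s <= t -> t <= b -> t - s < d -> `|f t - f s| < e.
  move=> as_ st tb std; have := dP 1%N (fun=> s) (fun=> t); rewrite !big_ord1.
  by apply=> // i j; rewrite !ord1.
move=> s t /andP[as_ sb] /andP[at_ tb]; have [st|ts] := leP s t.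
  by rewrite (ger0_norm (_ : 0 <= t - s)) ?subr_ge0//; exact: inc.
rewrite distrC (ger0_norm (_ : 0 <= s - t)) ?subr_ge0 ?ltW// distrC.
by apply: inc => //; exact: ltW.
Qed.

(** The function is frozen before [t0]: solutions are controlled only for nonnegative times, while
    the barrier argument asks for continuity on the whole line. *)
Lemma loc_abs_cont_continuous (f : R -> R) (t0 : R) : 0 <= t0 ->
  (forall T, 0 <= T -> abs_cont 0 T f) ->
  continuous (fun t : R => f (t0 + Num.max 0 t)).
Proof.
move=> t00 acf t; apply/cvgrPdist_lt => e e0.
pose T := t0 + (`|t| + 1).
have T0 : 0 <= T by rewrite !addr_ge0.
have [d d0 dP] := abs_cont_unif (acf T T0) e0.
apply/nbhs_ballP; exists (Num.min d 1); first by rewrite /= lt_min d0 ltr01.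
move=> s; rewrite /ball /= lt_min => /andP[sd s1].
have max_le r : r <= `|t| + 1 -> 0 <= t0 + Num.max 0 r <= T.
  move=> rt; rewrite addr_ge0 ?le_max ?lexx//= lerD2l ge_max rt andbT.
  by rewrite addr_ge0.
apply: dP.
- apply: max_le; have -> : s = t - (t - s) by ring.
  by rewrite (le_trans (ler_norm _))// (le_trans (ler_normB _ _))// lerD2l ltW.
- by apply: max_le; rewrite (le_trans (ler_norm _))// lerDl.
- apply: le_lt_trans sd; move: (ler_norm (t - s)) (ler_norm (s - t)).
  rewrite (distrC s t) => h1 h2.
  by rewrite ler_norml; case: (leP 0 t); case: (leP 0 s); lra.
Qed.

Variables (n : nat) (mu dinf L : R).
Hypotheses (mu01 : 0 < mu < 1) (dinf0 : 0 < dinf) (dinf1 : n%:R * dinf < 1).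

Local Notation N := n.+1.
Local Notation Phi := (PhiN mu (-1) dinf N).
Local Notation be := (rexp dinf N N.+1 / rexp dinf N N).

Lemma PhiN0 i : Phi i 0 = 0.
Proof.
elim: i => [//|i IH] /=; rewrite IH /phiN !spow0 !mulr0 addr0//.
Qed.

Lemma PhiNN i z : Phi i (- z) = - Phi i z.
Proof.
elim: i => [//|i IH] /=; rewrite IH /phiN !spowN !mulrN opprD//.
Qed.

Lemma phiN_last z : phiN mu (-1) dinf N N z = mu * Num.sg z + (1 - mu) * spow z be.
Proof.
rewrite /phiN; congr (_ * _ + _).
by rewrite (@rexpN1 R n N)// subnn mul0r /spow powRr0 mulr1.
Qed.

Lemma phiN_last_ge w z : 0 < w -> w <= z ->
  mu + (1 - mu) * w `^ be <= phiN mu (-1) dinf N N z.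
Proof.
move=> w0 wz; have z0 : 0 < z by exact: lt_le_trans wz.
have be0 : 0 < be by rewrite divr_gt0 ?rexp_gt0//.
rewrite phiN_last gtr0_sg// mulr1 spow_gt0E// lerD2l ler_wpM2l//.
  by have := mu01; lra.
by apply: ge0_ler_powR; rewrite ?nnegrE ?(ltW be0) ?(ltW w0) ?(ltW z0).
Qed.

Lemma norm_phiN_last B z : `|z| <= B ->
  `|phiN mu (-1) dinf N N z| <= mu + (1 - mu) * B `^ be.
Proof.
move=> zB; have [mu0 mu1] := andP mu01.
have be0 : 0 < be by rewrite divr_gt0 ?rexp_gt0//.
have mu1' : 0 <= 1 - mu by lra.
rewrite phiN_last (le_trans (ler_normD _ _))// normrM [`|(1 - mu) * _|]normrM.
rewrite (gtr0_norm mu0) (ger0_norm mu1').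
apply: lerD.
  by rewrite ler_piMr ?(ltW mu0)// normr_sg; case: eqP => //=; rewrite ler01.
apply: ler_wpM2l => //; apply: (le_trans (norm_spow _ _)).
by apply: ge0_ler_powR; rewrite ?nnegrE ?(ltW be0)// (le_trans _ zB).
Qed.

(* [xi] stands for the value selected by the Filippov regularisation of
   [Phi N], which is multivalued only at the origin. *)
Definition error_dynamics (kappa : nat -> R) (e : nat -> R -> R) (t : R) : Prop :=
  [/\ forall i, (i <= n)%N -> derivable (e i) t 1,
      forall i, (i < n)%N ->
        derive1 (e i) t = e i.+1 t - kappa i.+1 * Phi i.+1 (e 0%N t) &
      exists d xi, [/\ `|d| <= L, derive1 (e n) t = d - kappa N * xi,
        e 0%N t != 0 -> xi = Phi N (e 0%N t) & e 0%N t = 0 -> `|xi| <= mu]].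

(** Neither the gains nor [T] depend on the start [t0], since a block becomes autonomous only after
    the preceding ones have vanished. *)
Theorem error_chain_fixed_time : exists (kappa : nat -> R) (T : R),
  [/\ forall j, (1 <= j <= N)%N -> 0 < kappa j, 0 < T &
    forall e t0 (Z : set R), 0 <= t0 ->
      (forall i T', (i <= n)%N -> 0 <= T' -> abs_cont 0 T' (e i)) ->
      (@lebesgue_measure R).-negligible Z ->
      (forall t, t0 <= t -> ~ Z t -> error_dynamics kappa e t) ->
      forall t, t0 + T <= t -> forall i, (i <= n)%N -> e i t = 0].
Proof.
have [mu0 mu1] := andP mu01.
(* The bound [2 L / mu <= k n <= K N] makes the perturbation, once divided by [K N], at most
   [mu / 2]. *)
have [k [T [k1 kn T0 kT]]] := recursive_chain_fixed_time mu01 dinf0 dinf1 (2 * L / mu).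
pose K i : R := \prod_(j < i) k j.
have KS i : K i.+1 = K i * k i by rewrite /K big_ord_recr.
have K1 i : (i <= N)%N -> 1 <= K i.
  elim: i => [_|i IH i_n]; first by rewrite /K big_ord0.
  by rewrite KS mulr_ege1 ?k1// IH// ltnW.
have K0 i : (i <= N)%N -> 0 < K i by move=> /K1; exact: lt_le_trans.
have KL : L <= mu / 2 * K N.
  have h1 : 2 * L / mu <= K N.
    by rewrite KS (le_trans kn)// ler_peMl ?K1// (le_trans _ (k1 n (leqnn n))).
  move: h1; rewrite ler_pdivrMr//; lra.
have k0 : 0 < k n by rewrite (lt_le_trans _ (k1 n (leqnn n))).
exists K, T; split => //; first by move=> j /andP[_ jN]; exact: K0.
move=> e t0 Z t00 ace nZ dyn.
pose x i t := e i (t0 + Num.max 0 t) / K i.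
have xE i t : 0 <= t -> x i t = e i (t0 + t) / K i by move=> t_ge0; rewrite /x max_r.
have x0E t : 0 <= t -> x 0%N t = e 0%N (t0 + t).
  by move=> t_ge0; rewrite xE// /K big_ord0 divr1.
suff rc : recursive_chain n mu dinf k x.
  move=> t t0t i i_n; have t_ge0 : 0 <= t - t0 by lra.
  have := kT x rc (t - t0) ltac:(lra) i i_n; rewrite xE// addrC subrK.
  move/eqP; rewrite mulf_eq0 invr_eq0 => /orP[/eqP//|].
  by rewrite gt_eqF// K0// leqW.
have ac i t t' : (i <= n)%N -> 0 <= t -> t <= t' ->
    abs_cont (t0 + t) (t0 + t') (e i).
  move=> i_n t_ge0 tt'; apply: (@abs_cont_sub 0 (t0 + t')) => //; first by rewrite addr_ge0.
  by apply: ace => //; rewrite addr_ge0// (le_trans t_ge0).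
have der i s : (i <= n)%N -> error_dynamics K e s -> derivable (e i) s 1.
  by move=> i_n [+ _ _]; exact.
have diff i t t' : 0 <= t -> t <= t' ->
    x i t' - x i t = (e i (t0 + t') - e i (t0 + t)) / K i.
  by move=> t_ge0 tt'; rewrite !xE ?mulrBl// (le_trans t_ge0).
have incr_ub i t t' C : (i <= n)%N -> 0 <= t -> t <= t' ->
    (forall r, t <= r <= t' -> error_dynamics K e (t0 + r) ->
      derive1 (e i) (t0 + r) / K i <= C) ->
    x i t' - x i t <= C * (t' - t).
  move=> i_n t_ge0 tt' H; have Ki0 : 0 < K i by rewrite K0// leqW.
  rewrite diff// ler_pdivrMr//.
  have -> : C * (t' - t) * K i = C * K i * (t0 + t' - (t0 + t)) by ring.
  apply: (abs_cont_increment_ub _ (ac i t t' i_n t_ge0 tt') nZ); first by rewrite lerD2l.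
  move=> s /andP[s1 s2] nZs; have dyns : error_dynamics K e s by apply: dyn => //; lra.
  split; first exact: der.
  have sE : s = t0 + (s - t0) by ring.
  have := H (s - t0) ltac:(lra); rewrite -sE => /(_ dyns).
  by rewrite ler_pdivrMr.
have incr_lb i t t' C : (i <= n)%N -> 0 <= t -> t <= t' ->
    (forall r, t <= r <= t' -> error_dynamics K e (t0 + r) ->
      C <= derive1 (e i) (t0 + r) / K i) ->
    C * (t' - t) <= x i t' - x i t.
  move=> i_n t_ge0 tt' H; have Ki0 : 0 < K i by rewrite K0// leqW.
  rewrite diff// ler_pdivlMr//.
  have -> : C * (t' - t) * K i = C * K i * (t0 + t' - (t0 + t)) by ring.
  apply: (abs_cont_increment_lb _ (ac i t t' i_n t_ge0 tt') nZ); first by rewrite lerD2l.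
  move=> s /andP[s1 s2] nZs; have dyns : error_dynamics K e s by apply: dyn => //; lra.
  split; first exact: der.
  have sE : s = t0 + (s - t0) by ring.
  have := H (s - t0) ltac:(lra); rewrite -sE => /(_ dyns).
  by rewrite ler_pdivlMr.
have vel i r : (i < n)%N -> 0 <= r -> error_dynamics K e (t0 + r) ->
    derive1 (e i) (t0 + r) / K i = k i * (x i.+1 r - Phi i.+1 (x 0%N r)).
  move=> i_n r0 [_ dyni _]; rewrite dyni// x0E// xE// KS.
  have Ki0 : K i != 0 by rewrite gt_eqF// K0// leqW// ltnW.
  have ki0 : k i != 0 by rewrite gt_eqF// (lt_le_trans _ (k1 i (ltnW i_n))).
  by field; rewrite Ki0 ki0.
have vel_last r : 0 <= r -> error_dynamics K e (t0 + r) ->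
    exists d xi, [/\ `|d| <= mu / 2, derive1 (e n) (t0 + r) / K n = k n * (d - xi),
      x 0%N r != 0 -> xi = Phi N (x 0%N r) & x 0%N r = 0 -> `|xi| <= mu].
  move=> r0 [_ _ [d [xi [dL dyn_n xi1 xi2]]]]; exists (d / K N), xi; split.
  - rewrite normrM [X in _ * X]gtr0_norm ?invr_gt0 ?K0// ler_pdivrMr ?K0//.
    exact: le_trans KL.
  - rewrite dyn_n KS; have Kn0 : K n != 0 by rewrite gt_eqF// K0.
    by field; rewrite Kn0 gt_eqF.
  - by rewrite x0E.
  - by rewrite x0E.
split.
- move=> i i_n z; apply: cvgM; last exact: cvg_cst.
  apply: loc_abs_cont_continuous => // T' T'0; exact: ace.
- move=> i t t' A i_n t_ge0 tt' H; apply: incr_ub => //; first exact: ltnW.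
  by move=> r /andP[tr rt'] dynr; rewrite vel ?(le_trans t_ge0)// H// tr.
- move=> i t t' A i_n t_ge0 tt' H; apply: incr_lb => //; first exact: ltnW.
  by move=> r /andP[tr rt'] dynr; rewrite vel ?(le_trans t_ge0)// H// tr.
- move=> t t' w w0 t_ge0 tt' H; rewrite -[leRHS]mulNr; apply: incr_ub => // r trt' dynr.
  have r0 : 0 <= r by case/andP: trt' => + _; exact: le_trans.
  have [d [xi [dm -> xi1 _]]] := vel_last r r0 dynr.
  have wP := H r trt'.
  rewrite -mulrN ler_pM2l// xi1; last first.
    by apply/eqP => x00; move: wP; rewrite x00 PhiN0 leNgt w0.
  have := phiN_last_ge w0 wP; have := ler_norm d; rewrite -[Phi N _]/(phiN _ _ _ _ _ _).
  lra.
- move=> t t' w w0 t_ge0 tt' H; apply: incr_lb => // r trt' dynr.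
  have r0 : 0 <= r by case/andP: trt' => + _; exact: le_trans.
  have [d [xi [dm -> xi1 _]]] := vel_last r r0 dynr.
  have wP : w <= Phi n (- x 0%N r) by rewrite PhiNN; have := H r trt'; lra.
  rewrite ler_pM2l// xi1; last first.
    by apply/eqP => x00; move: wP; rewrite x00 oppr0 PhiN0 leNgt w0.
  have := phiN_last_ge w0 wP; have := ler_norm (- d); rewrite normrN.
  have := PhiNN N (x 0%N r); rewrite -[Phi N (- _)]/(phiN _ _ _ _ _ (Phi n (- _))).
  lra.
- move=> t t' B B0 t_ge0 tt' H.
  have bnd r : t <= r <= t' -> error_dynamics K e (t0 + r) ->
      `|derive1 (e n) (t0 + r) / K n| <= k n * (2 * mu + (1 - mu) * B `^ be).
    move=> trt' dynr; have r0 : 0 <= r by case/andP: trt' => + _; exact: le_trans.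
    have [d [xi [dm -> xi1 xi2]]] := vel_last r r0 dynr.
    rewrite normrM gtr0_norm// ler_pM2l// (le_trans (ler_normB _ _))//.
    have pB : 0 <= (1 - mu) * B `^ be by rewrite mulr_ge0 ?powR_ge0//; lra.
    have xiB : `|xi| <= mu + (1 - mu) * B `^ be.
      have [x00|xn0] := eqVneq (x 0%N r) 0; first by have := xi2 x00; lra.
      by rewrite xi1//; exact: norm_phiN_last (H r trt').
    lra.
  rewrite ler_norml; apply/andP; split.
    rewrite -[leLHS]mulNr; apply: incr_lb => // r trt' dynr; have := bnd r trt' dynr.
    by rewrite ler_norml => /andP[].
  apply: incr_ub => // r trt' dynr; have := bnd r trt' dynr.
  by rewrite ler_norml => /andP[].
Qed.

End ErrorChain.

(** * Block coordinates and Filippov values *)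

Section BlockIndex.
Variables (R : realType) (k : nat) (q : 'I_k -> nat).

Let psum (m : nat) : nat := \sum_(j < k | (j < m)%N) q j.

Let psumS (i : 'I_k) : psum i.+1 = (psum i + q i)%N.
Proof.
rewrite /psum (bigD1 i)//= addnC; congr (_ + _)%N.
by apply: eq_bigl => j; rewrite ltnS [RHS]ltn_neqAle andbC.
Qed.

Let psum_mono m m' : (m <= m')%N -> (psum m <= psum m')%N.
Proof.
move=> mm'; rewrite /psum big_mkcond [leqRHS]big_mkcond; apply: leq_sum => j _.
by case: ifP => // jm; rewrite (leq_trans jm).
Qed.

Let psum_full : psum k = bdim q.
Proof. by rewrite /psum /bdim; apply: eq_bigl => j; rewrite ltn_ord. Qed.

Lemma boff_lt (i : 'I_k) j : (j < q i)%N -> (boff q i + j < bdim q)%N.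
Proof.
move=> jq; rewrite -psum_full (@leq_trans (psum i.+1))//; last exact: psum_mono.
by rewrite psumS -addnS leq_add2l.
Qed.

(** The block matrices are defined by equations between positions; this uniqueness discards all
    entries but the intended one. *)
Lemma boff_inj (i i' : 'I_k) j j' : (j < q i)%N -> (j' < q i')%N ->
  (boff q i + j = boff q i' + j')%N -> i = i' /\ j = j'.
Proof.
have lt (a b : 'I_k) u v : (u < q a)%N -> (a < b)%N -> (boff q a + u < boff q b + v)%N.
  move=> ua ab; rewrite (@leq_trans (psum a.+1))//.
    by rewrite psumS -addnS leq_add2l.
  by rewrite (leq_trans (psum_mono ab))// leq_addr.
move=> jq jq' E; have [ii'|i'i|/val_inj ii'] := ltngtP i i'.
- by have := lt _ _ j j' jq ii'; rewrite E ltnn.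
- by have := lt _ _ j' j jq' i'i; rewrite E ltnn.
- by subst i'; split => //; apply/eqP; rewrite -(eqn_add2l (boff q i)) E.
Qed.

Lemma bdim_split (c : nat) : (c < bdim q)%N ->
  exists (i : 'I_k) (j : nat), (j < q i)%N /\ c = (boff q i + j)%N.
Proof.
rewrite -psum_full.
suff aux m : (m <= k)%N -> (c < psum m)%N ->
    exists (i : 'I_k) (j : nat), (j < q i)%N /\ c = (boff q i + j)%N by exact: aux.
elim: m => [|m IH] mk; first by rewrite /psum big1.
have [cm _|mc] := ltnP c (psum m); first exact: IH (ltnW mk) cm.
rewrite (psumS (Ordinal mk)) /= => cm; exists (Ordinal mk), (c - psum m)%N.
by rewrite ltn_subLR// subnKC.
Qed.

(** Natural indices, with default 0 out of range, let positions [boff q i + j] be used without a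
    proof that they are ordinals. *)
Definition vcomp (v : 'cV[R]_(bdim q)) (r : nat) : R :=
  oapp (fun c => v c ord0) 0 (insub r).

Lemma vcompE v (c : 'I_(bdim q)) : vcomp v c = v c ord0.
Proof. by rewrite /vcomp valK. Qed.

Lemma vcomp_ord v r (h : (r < bdim q)%N) : vcomp v r = v (Ordinal h) ord0.
Proof. exact: (vcompE v (Ordinal h)). Qed.

Lemma vcompD u v r : vcomp (u + v) r = vcomp u r + vcomp v r.
Proof. by rewrite /vcomp; case: insub => [c|] /=; rewrite ?mxE ?addr0. Qed.

Lemma vcompB u v r : vcomp (u - v) r = vcomp u r - vcomp v r.
Proof. by rewrite /vcomp; case: insub => [c|] /=; rewrite ?mxE ?subr0. Qed.

Lemma vcomp_J v (i : 'I_k) j : (j < q i)%N ->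
  vcomp (Jblk q *m v) (boff q i + j) =
  if (j.+1 < q i)%N then vcomp v (boff q i + j).+1 else 0.
Proof.
move=> jq; rewrite (vcomp_ord _ (boff_lt jq)) mxE.
case: ifP => [j1q|j1q].
  have h : ((boff q i + j).+1 < bdim q)%N by rewrite -addnS boff_lt.
  rewrite (vcomp_ord _ h) (bigD1 (Ordinal h))//= big1 ?addr0.
    rewrite mxE /=; case: existsP => [_|]; first by rewrite mul1r.
    case; exists i; apply/existsP; exists (Ordinal jq) => /=.
    by rewrite !eqxx j1q.
  move=> c ch; rewrite mxE; case: existsP; rewrite ?mul0r// => -[i' /existsP[j' /=]].
  move=> /and3P[_ _ /eqP E]; case/eqP: ch; exact/val_inj.
rewrite big1// => c _; rewrite mxE; case: existsP; rewrite ?mul0r// => -[i' /existsP[j' /=]].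
move=> /and3P[/eqP E j'q _].
by have [ii' jj'] := boff_inj jq (ltn_ord j') E; subst i'; rewrite -jj' j1q in j'q.
Qed.

Lemma vcomp_B (w : 'cV[R]_k) (i : 'I_k) j : (j < q i)%N ->
  vcomp (Bblk q *m w) (boff q i + j) = if (j.+1 < q i)%N then 0 else w i ord0.
Proof.
move=> jq; rewrite (vcomp_ord _ (boff_lt jq)) mxE.
have zero i' : ~~ ((i' == i) && ~~ (j.+1 < q i)%N) ->
    Bblk q (Ordinal (boff_lt jq)) i' * w i' ord0 = 0.
  move=> H; rewrite mxE /=; case: andP => [[/eqP E q0]|]; last by rewrite mul0r.
  have [ii' jj'] := boff_inj jq (ltac:(by rewrite prednK) : ((q i').-1 < q i')%N) E.
  by subst i'; move: H; rewrite eqxx jj' prednK// ltnn.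
case: ifP => j1q; first by rewrite big1// => i' _; apply: zero; rewrite j1q andbF.
rewrite (bigD1 i)//= big1 => [|i' ii']; last by apply: zero; rewrite negb_and ii'.
have jE : j = (q i).-1 by have := jq; move: (negbT j1q); lia.
by rewrite mxE /= -jE eqxx (leq_ltn_trans _ jq)//= mul1r addr0.
Qed.

Lemma Cblk_comp v (i : 'I_k) : (0 < q i)%N -> (Cblk q *m v) i ord0 = vcomp v (boff q i).
Proof.
move=> q0; have h := boff_lt q0; rewrite addn0 in h.
rewrite (vcomp_ord _ h) mxE (bigD1 (Ordinal h))//= big1 => [|c ch].
  by rewrite mxE /= eqxx q0 mul1r addr0.
rewrite mxE; case: andP => [[/eqP E _]|]; rewrite ?mul0r//.
by case/eqP: ch; exact/val_inj.
Qed.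

Lemma vcomp_linj mu d0 dinf g (e : 'cV[R]_k) (i : 'I_k) j : (j < q i)%N ->
  vcomp (linj q mu d0 dinf g e) (boff q i + j) =
  g i j.+1 * PhiN mu d0 dinf (q i) j.+1 (e i ord0).
Proof.
move=> jq; rewrite (vcomp_ord _ (boff_lt jq)) mxE (bigD1 i)//=.
rewrite (bigD1 (Ordinal jq))//= !big1 ?addr0//.
- move=> i' ii'; rewrite big1// => j' /eqP E.
  have [ii _] := boff_inj jq (ltn_ord j') E.
  by rewrite ii eqxx in ii'.
- move=> j' /andP[/eqP E jj'].
  have [_ jj] := boff_inj jq (ltn_ord j') E.
  by case/eqP: jj'; apply/val_inj.
Qed.

Lemma vcomp_continuous r : continuous (fun v => vcomp v r).
Proof.
move=> v; rewrite /vcomp; case: insub => [c|] /=; last exact: (@cst_continuous _ _ (0 : R)).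
exact: coord_continuous.
Qed.

End BlockIndex.

(** * Components of Filippov values *)

Section Filippov.
Variable R : realType.

(** A closed half-space that contains the values of [f] near [x] contains their convex combinations
    and the limits of these. The empty null set suffices. *)
Lemma filippov_ub n (f : 'cV[R]_n -> 'cV[R]_n) x v (r : 'I_n) (a c : R) :
  `|a| <= 1 -> filippov f x v ->
  (\forall y \near x, a * f y r ord0 <= c) -> a * v r ord0 <= c.
Proof.
move=> a1 Fv /nbhs_ballP[d /= d0 dP].
have null0 : Defs.null_set (set0 : set 'cV[R]_n).
  move=> e e0; exists (fun=> 0), (fun=> 0); split => // m.
  (* The index [r] supplies a zero factor; for [n = 0] the product would be 1. *)
  by rewrite big1// => l _; rewrite (bigD1 r)//= subrr mul0r.
apply/ler_addgt0Pr => e e0.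
have [s [l [w [p [w0 w1 pS ->]]]] sv] := Fv d d0 _ null0 e e0.
have le_c : \sum_(i < l) w i * (a * p i r ord0) <= c.
  rewrite -[leRHS]mul1r -w1 mulr_suml; apply: ler_sum => i _.
  apply: ler_wpM2l => //; have [y [yx _] <-] := pS i; apply: dP; split => // b b'.
  by rewrite ord1 /ball /= distrC; exact: yx.
have := sv r; rewrite summxE.
set t := \sum_(i < l) _ => st.
have tE : \sum_(i < l) w i * (a * p i r ord0) = a * t.
  by rewrite mulr_sumr; apply: eq_bigr => i _; rewrite mxE mulrCA.
have : `|a * (t - v r ord0)| <= e.
  by rewrite normrM (le_trans _ (ltW st))// ler_piMl.
rewrite mulrBr ler_norml => /andP[h _]; rewrite tE in le_c; lra.
Qed.

(** With [c = 0] the regularisation leaves a component that agrees near [x] with a function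
    continuous at [x] unchanged; with [c > 0] it bounds the spread at a jump. *)
Lemma filippov_close n (f : 'cV[R]_n -> 'cV[R]_n) x v (r : 'I_n) (H : 'cV[R]_n -> R) c :
  filippov f x v -> {for x, continuous H} ->
  (\forall y \near x, `|f y r ord0 - H y| <= c) -> `|v r ord0 - H x| <= c.
Proof.
move=> Fv cH close.
have near_H e : 0 < e -> \forall y \near x, `|H x - H y| <= e.
  by move: cH => /cvgrPdist_le; exact.
have sided (a : R) : `|a| = 1 -> a * (v r ord0 - H x) <= c.
  move=> a1; apply/ler_addgt0Pr => e e0; rewrite mulrBr lerBlDr.
  apply: (filippov_ub _ Fv); first by rewrite a1.
  near=> y.
  have : `|a * (f y r ord0 - H y)| <= c by rewrite normrM a1 mul1r; near: y.
  have : `|a * (H x - H y)| <= e.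
    by rewrite normrM a1 mul1r; near: y; exact: near_H.
  by rewrite !mulrBr !ler_norml => /andP[h1 h2] /andP[h3 h4]; lra.
rewrite ler_norml; have := sided 1 (normr1 _); have := sided (-1).
by rewrite normrN normr1 mulN1r mul1r => /(_ erefl) h1 h2; apply/andP; split; lra.
Unshelve. all: by end_near. Qed.

End Filippov.

Section RealContinuity.
Variables (R : realType) (T : topologicalType).
Implicit Types f g : T -> R.

Lemma continuous_addf f g : continuous f -> continuous g -> continuous (fun x => f x + g x).
Proof. by move=> cf cg x; exact: (continuousD (cf x) (cg x)). Qed.

Lemma continuous_subf f g : continuous f -> continuous g -> continuous (fun x => f x - g x).
Proof. by move=> cf cg x; exact: (continuousB (cf x) (cg x)). Qed.

Lemma continuous_mulf f g : continuous f -> continuous g -> continuous (fun x => f x * g x).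
Proof. by move=> cf cg x; exact: (continuousM (cf x) (cg x)). Qed.

End RealContinuity.

Section FilippovBlock.
Variables (R : realType) (n : nat) (mu dinf : R).
Hypotheses (mu01 : 0 < mu < 1) (dinf0 : 0 < dinf) (dinf1 : n%:R * dinf < 1).

Local Notation N := n.+1.
Local Notation Phi := (PhiN mu (-1) dinf N).
Local Notation be := (rexp dinf N N.+1 / rexp dinf N N).

Lemma PhiN_continuous i : (i <= n)%N -> continuous (Phi i).
Proof.
elim: i => [_|i IH i_n]; first by move=> z; exact: cvg_id.
move=> z; apply: (@continuous_comp _ _ _ (Phi i) (phiN mu (-1) dinf N i.+1)).
  exact: IH (ltnW i_n) z.
apply: bipow_continuous; first exact: sub_exponent_gt0.
exact: super_exponent_ge1.
Qed.

Lemma PhiN_neq0 i z : z != 0 -> Phi i z != 0.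
Proof.
have pos y : 0 < y -> 0 < Phi i y.
  move=> y0; elim: i => [//|i IH] /=; have /andP[mu0 mu1] := mu01.
  by rewrite /phiN !spow_gt0E// addr_gt0// mulr_gt0 ?powR_gt0// subr_gt0.
rewrite neq_lt => /orP[z0|/pos]; last by rewrite lt0r => /andP[].
by rewrite -oppr_eq0 -PhiNN gt_eqF// pos// oppr_gt0.
Qed.

Variables (k : nat) (q : 'I_k -> nat) (F : 'M[R]_(k, bdim q)) (i : 'I_k).
Variables (w x v : 'cV[R]_(bdim q)) (z : 'cV[R]_k) (g : 'I_k -> nat -> R).
Hypothesis qi : q i = N.

Let f (xi : 'cV[R]_(bdim q)) := Jblk q *m xi + Bblk q *m (F *m xi) + w
  + linj q mu (-1) dinf g (z - Cblk q *m xi).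
Let err (xi : 'cV[R]_(bdim q)) := z i ord0 - vcomp xi (boff q i).

Hypothesis Fv : filippov f x v.

Let fE xi j : (j < N)%N -> vcomp (f xi) (boff q i + j) =
  (if (j < n)%N then vcomp xi (boff q i + j).+1 else (F *m xi) i ord0)
  + vcomp w (boff q i + j) + g i j.+1 * Phi j.+1 (err xi).
Proof.
move=> jN; have jq : (j < q i)%N by rewrite qi.
rewrite /f !vcompD vcomp_J// vcomp_B// vcomp_linj// qi ltnS.
rewrite [(z - _) i ord0]mxE [(- (_ *m _)) i ord0]mxE Cblk_comp ?qi//.
by case: ifP => _; rewrite ?addr0 ?add0r.
Qed.

Let err_continuous : continuous err.
Proof.
by apply: continuous_subf; [exact: cst_continuous|exact: vcomp_continuous].
Qed.

Let Phi_err_continuous j : (j <= n)%N -> continuous (fun xi => Phi j (err xi)).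
Proof.
move=> jn xi; apply: (@continuous_comp _ _ _ err (Phi j)); first exact: err_continuous.
exact: PhiN_continuous.
Qed.

Let near_all (P : 'cV[R]_(bdim q) -> Prop) : (forall xi, P xi) -> \forall xi \near x, P xi.
Proof. by move=> Pxi; near=> xi; exact: Pxi. Unshelve. all: by end_near. Qed.

Let close j H c : (j < N)%N -> {for x, continuous H} ->
  (\forall xi \near x, `|vcomp (f xi) (boff q i + j) - H xi| <= c) ->
  `|vcomp v (boff q i + j) - H x| <= c.
Proof.
move=> jN cH near_c; have h : (boff q i + j < bdim q)%N by apply: boff_lt; rewrite qi.
rewrite (vcomp_ord _ h); apply: (filippov_close Fv cH).
by apply: filterS near_c => xi; rewrite (vcomp_ord _ h).
Qed.

Lemma filippov_block_inner j : (j < n)%N -> vcomp v (boff q i + j) =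
  vcomp x (boff q i + j).+1 + vcomp w (boff q i + j) + g i j.+1 * Phi j.+1 (err x).
Proof.
move=> jn; have jN : (j < N)%N by exact: ltnW.
pose H xi := vcomp xi (boff q i + j).+1 + vcomp w (boff q i + j)
  + g i j.+1 * Phi j.+1 (err xi).
apply/eqP; rewrite -subr_eq0 -normr_le0 -[X in _ - X]/(H x).
have cH : continuous H.
  apply: continuous_addf.
    by apply: continuous_addf; [exact: vcomp_continuous|exact: cst_continuous].
  by apply: continuous_mulf; [exact: cst_continuous|exact: Phi_err_continuous].
apply: close (cH x) _ => //.
by apply: near_all => xi; rewrite fE// jn subrr normr0.
Qed.

(** [xi] is obtained by solving the first equation. If [err x] is nonzero the sign is constant near
    [x]; otherwise the rest of the row is continuous and the sign contributes at most
    [g i N * mu]. *)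
Lemma filippov_block_last : 0 < g i N -> exists xi,
  [/\ vcomp v (boff q i + n) =
      (F *m x) i ord0 + vcomp w (boff q i + n) + g i N * xi,
    err x != 0 -> xi = Phi N (err x) & err x = 0 -> `|xi| <= mu].
Proof.
move=> g0; have /andP[mu0 mu1] := mu01.
have be0 : 0 < be by rewrite divr_gt0 ?rexp_gt0.
pose H xi := (F *m xi) i ord0 + vcomp w (boff q i + n)
  + g i N * ((1 - mu) * spow (Phi n (err xi)) be).
pose s xi := g i N * (mu * Num.sg (Phi n (err xi))).
have fH xi : vcomp (f xi) (boff q i + n) = H xi + s xi.
  rewrite fE// ltnn /H /s -[Phi N _]/(phiN _ _ _ _ _ _) phiN_last; ring.
have cF : continuous (fun xi : 'cV[R]_(bdim q) => (F *m xi) i ord0).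
  have csum r : continuous (fun xi : 'cV[R]_(bdim q) => \sum_(c <- r) F i c * xi c ord0).
    elim: r => [|c r IH].
      rewrite [X in continuous X](_ : _ = fun=> 0); first exact: cst_continuous.
      by apply/funext => xi; rewrite big_nil.
    rewrite [X in continuous X](_ : _ = fun xi : 'cV[R]_(bdim q) =>
      F i c * xi c ord0 + \sum_(c <- r) F i c * xi c ord0).
      apply: continuous_addf => //.
      by apply: continuous_mulf; [exact: cst_continuous|exact: coord_continuous].
    by apply/funext => xi; rewrite big_cons.
  have sumE : (fun xi : 'cV[R]_(bdim q) => (F *m xi) i ord0) =
      fun xi => \sum_c F i c * xi c ord0 by apply/funext => xi; rewrite mxE.
  by have := csum (index_enum 'I_(bdim q)); rewrite -sumE.
have cH : continuous H.
  apply: continuous_addf.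
    by apply: continuous_addf; [exact: cF|exact: cst_continuous].
  apply: continuous_mulf; first exact: cst_continuous.
  apply: continuous_mulf; first exact: cst_continuous.
  move=> xi; apply: (@continuous_comp _ _ _ (fun xi => Phi n (err xi)) (fun y => spow y be)).
    exact: Phi_err_continuous.
  exact: spow_continuous.
exists ((vcomp v (boff q i + n) - (F *m x) i ord0 - vcomp w (boff q i + n)) / g i N).
split.
- by rewrite mulrC divfK ?gt_eqF//; ring.
- move=> e0; have P0 := PhiN_neq0 n e0.
  have near_sg : \forall xi \near x, Num.sg (Phi n (err xi)) = Num.sg (Phi n (err x)).
    have cP := @Phi_err_continuous n (leqnn n) x.
    move: P0; rewrite neq_lt => /orP[P0|P0].
      by near=> xi; rewrite (ltr0_sg P0) ltr0_sg//; near: xi; exact: (cvgr_lt _ cP).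
    by near=> xi; rewrite (gtr0_sg P0) gtr0_sg//; near: xi; exact: (cvgr_gt _ cP).
  have : `|vcomp v (boff q i + n) - (H x + s x)| <= 0.
    apply: (@close n (fun xi => H xi + s x)) => //.
      exact: (continuous_addf cH (@cst_continuous _ _ (s x))).
    by near=> xi; rewrite fH /s (_ : Num.sg (Phi n (err xi)) = Num.sg (Phi n (err x)))
      ?subrr ?normr0//; near: xi.
  rewrite normr_le0 subr_eq0 => /eqP ->.
  rewrite /H /s -[Phi N _]/(phiN _ _ _ _ _ _) phiN_last; field.
  by rewrite gt_eqF.
- move=> e0.
  have : `|vcomp v (boff q i + n) - H x| <= g i N * mu.
    apply: (close _ (cH x)) => //; apply: near_all => xi.
    rewrite fH addrAC subrr add0r /s normrM gtr0_norm// ler_pM2l//.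
    rewrite normrM gtr0_norm// ler_piMr ?(ltW mu0)// normr_sg.
    by case: eqP => //=; rewrite ler01.
  rewrite /H e0 PhiN0 spow0 !mulr0 addr0 => h.
  by rewrite normrM [X in _ * X]gtr0_norm ?invr_gt0// ler_pdivrMr// mulrC -addrA -opprD.
Unshelve. all: by end_near. Qed.

End FilippovBlock.

(** The term [w], common to plant and observer, cancels, and the vanishing of row [i] of
    [F *m (x - xh)] removes the coupling; [ud] remains as the perturbation. *)
Lemma block_error_velocity (R : realType) (k : nat) (q : 'I_k -> nat) (F : 'M[R]_(k, bdim q))
    (i : 'I_k) (mu dinf : R) (g : 'I_k -> nat -> R) (w x xh dx dxh : 'cV[R]_(bdim q))
    (ud : 'cV[R]_k) :
  0 < mu < 1 -> 0 < dinf -> (q i).-1%:R * dinf < 1 -> (0 < q i)%N -> 0 < g i (q i) ->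
  dx = Jblk q *m x + Bblk q *m (F *m x) + w + Bblk q *m ud ->
  filippov (fun xi => Jblk q *m xi + Bblk q *m (F *m xi) + w
    + linj q mu (-1) dinf g (Cblk q *m x - Cblk q *m xi)) xh dxh ->
  (F *m (x - xh)) i ord0 = 0 ->
  let err j := vcomp (x - xh) (boff q i + j) in
  (forall j, (j < (q i).-1)%N -> vcomp (dx - dxh) (boff q i + j) =
     err j.+1 - g i j.+1 * PhiN mu (-1) dinf (q i) j.+1 (err 0%N)) /\
  exists xi, [/\ vcomp (dx - dxh) (boff q i + (q i).-1) = ud i ord0 - g i (q i) * xi,
    err 0%N != 0 -> xi = PhiN mu (-1) dinf (q i) (q i) (err 0%N) &
    err 0%N = 0 -> `|xi| <= mu].
Proof.
move=> mu01 dinf0 dinf1 q0 g0 -> Fdxh F0 err.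
have qN : q i = (q i).-1.+1 by rewrite prednK.
have err0 : (Cblk q *m x) i ord0 - vcomp xh (boff q i) = err 0%N.
  by rewrite Cblk_comp// /err addn0 vcompB.
have F0' : (F *m x) i ord0 = (F *m xh) i ord0.
  by apply/eqP; rewrite -subr_eq0; move: F0; rewrite mulmxBr !mxE => ->.
split.
  move=> j jn; have jq : (j < q i)%N by rewrite qN ltnW.
  have j1q : (j.+1 < q i)%N by rewrite qN.
  rewrite vcompB (filippov_block_inner dinf0 dinf1 qN Fdxh jn) err0 -qN.
  rewrite !vcompD vcomp_J// !vcomp_B// j1q -[err j.+1]/(vcomp _ _) vcompB addnS.
  by move: (g i j.+1 * _) (vcomp x _) (vcomp xh _) (vcomp w _) => *; ring.
have [|xi [dxhE xi1 xi2]] := filippov_block_last mu01 dinf0 dinf1 qN Fdxh; first by rewrite -qN.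
have nq : ((q i).-1 < q i)%N by rewrite {2}qN.
exists xi; rewrite err0 -qN in dxhE xi1 xi2; split => //.
rewrite vcompB dxhE !vcompD vcomp_J// !vcomp_B// -qN ltnn F0'.
by move: (g i _ * _) ((F *m xh) i ord0) (vcomp w _) (ud i ord0) => *; ring.
Qed.

(** * The cascade of blocks *)

Theorem theorem4 (R : realType)
  (m0 md pb : nat)
  (l : 'I_pb -> nat) (q : 'I_md -> nat)
  (Hl : forall i, (0 < l i)%N)
  (Hq : forall i, (0 < q i)%N)
  (Hqmono : forall i j : 'I_md, (i <= j)%N -> (q j <= q i)%N)
  (* output matrix of y0 *)
  (C0b : 'M[R]_(m0, bdim l)) (C0d : 'M[R]_(m0, bdim q))
  (* b-subsystem data *)
  (Hbb : 'M[R]_(bdim l, pb)) (Hbd : 'M[R]_(bdim l, md)) (B0b : 'M[R]_(bdim l, m0))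
  (* d-subsystem data *)
  (Fdb : 'M[R]_(md, bdim l)) (Fdd : 'M[R]_(md, bdim q))
  (Hdd : 'M[R]_(bdim q, md)) (B0d : 'M[R]_(bdim q, m0))
  (* structure of F_dd: f_{i,j,k} = 0 whenever j >= i or k = 1 *)
  (HFdd : forall (i j : 'I_md) (k : nat) (c : 'I_(bdim q)),
      (k < q j)%N -> (c : nat) = (boff q j + k)%N ->
      ((i <= j)%N \/ k = 0%N) -> Fdd i c = 0)
  (* parameters and gains of the x_b observer *)
  (mub d0b dinfb : R) (nu : 'I_pb -> nat -> R)
  (Hmub : 0 < mub < 1) (Hd0b : -1 < d0b < 0) (Hdinfb : 0 < dinfb)
  (Hdinfb' : forall i, ((l i).-1)%:R * dinfb < 1)
  (Hnu : forall i j, (1 <= j <= l i)%N -> 0 < nu i j)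
  (* they are chosen such that x_b - xhat_b vanishes after a fixed time *)
  (Hb : exists2 Tb : R, 0 < Tb &
     forall (xb : R -> 'cV[R]_(bdim l)) (xd : R -> 'cV[R]_(bdim q))
            (u0 : R -> 'cV[R]_m0) (ud : R -> 'cV[R]_md)
            (xhb : R -> 'cV[R]_(bdim l)),
       let y0 := fun t => C0b *m xb t + C0d *m xd t + u0 t in
       let yb := fun t => Cblk l *m xb t in
       let yd := fun t => Cblk q *m xd t in
       cara_sol xb (fun t => (Jblk l + Hbb *m Cblk l) *m xb t
                              + Hbd *m Cblk q *m xd t + B0b *m y0 t) ->
       cara_sol xd (fun t => Bblk q *m Fdb *m xb t
                      + (Jblk q + Bblk q *m Fdd + Hdd *m Cblk q) *m xd t
                      + B0d *m y0 t + Bblk q *m ud t) ->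
       filippov_sol (fun t xi => Jblk l *m xi + Hbb *m yb t + Hbd *m yd t
                       + B0b *m y0 t
                       + linj l mub d0b dinfb nu (yb t - Cblk l *m xi)) xhb ->
       forall t, Tb <= t -> xb t = xhb t) :
  forall (mu dinf : R), 0 < mu < 1 -> 0 < dinf ->
  (forall i, ((q i).-1)%:R * dinf < 1) ->
  forall L : R, 0 <= L ->
  exists kappa : 'I_md -> nat -> R,
    (forall i j, (1 <= j <= q i)%N -> 0 < kappa i j) /\
    exists2 T : R, 0 < T &
     forall (xb : R -> 'cV[R]_(bdim l)) (xd : R -> 'cV[R]_(bdim q))
            (u0 : R -> 'cV[R]_m0) (ud : R -> 'cV[R]_md)
            (xhb : R -> 'cV[R]_(bdim l)) (xhd : R -> 'cV[R]_(bdim q)),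
       let y0 := fun t => C0b *m xb t + C0d *m xd t + u0 t in
       let yb := fun t => Cblk l *m xb t in
       let yd := fun t => Cblk q *m xd t in
       cara_sol xb (fun t => (Jblk l + Hbb *m Cblk l) *m xb t
                              + Hbd *m Cblk q *m xd t + B0b *m y0 t) ->
       cara_sol xd (fun t => Bblk q *m Fdb *m xb t
                      + (Jblk q + Bblk q *m Fdd + Hdd *m Cblk q) *m xd t
                      + B0d *m y0 t + Bblk q *m ud t) ->
       (forall t, 0 <= t -> forall i, `| ud t i ord0 | <= L) ->
       filippov_sol (fun t xi => Jblk l *m xi + Hbb *m yb t + Hbd *m yd t
                       + B0b *m y0 t
                       + linj l mub d0b dinfb nu (yb t - Cblk l *m xi)) xhb ->
       filippov_sol (fun t xi => (Jblk q + Bblk q *m Fdd) *m xi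
                       + Bblk q *m Fdb *m xhb t + B0d *m y0 t + Hdd *m yd t
                       + linj q mu (-1) dinf kappa (yd t - Cblk q *m xi)) xhd ->
       forall t, T <= t -> xd t = xhd t.
Proof.
move=> mu dinf mu01 dinf0 dinfq L L0.
have chain i : exists p : (nat -> R) * R,
    [/\ forall j, (1 <= j <= q i)%N -> 0 < p.1 j, 0 < p.2 &
      forall e t0 (Z : set R), 0 <= t0 ->
        (forall j T', (j <= (q i).-1)%N -> 0 <= T' -> abs_cont 0 T' (e j)) ->
        (@lebesgue_measure R).-negligible Z ->
        (forall t, t0 <= t -> ~ Z t -> error_dynamics (q i).-1 mu dinf L p.1 e t) ->
        forall t, t0 + p.2 <= t -> forall j, (j <= (q i).-1)%N -> e j t = 0].
  have [kap [T [kap0 T0 kapT]]] := error_chain_fixed_time L mu01 dinf0 (dinfq i).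
  by exists (kap, T); split => // j; rewrite -{1}(prednK (Hq i)); exact: kap0.
have /choice[p pP] := chain.
have [Tb Tb0 xbT] := Hb.
pose Tof (m : nat) : R := Tb + \sum_(i < md | (i < m)%N) (p i).2.
exists (fun i => (p i).1); split.
  by move=> i j; have [+ _ _] := pP i; exact.
have p0 i : 0 <= (p i).2 by have [_ /ltW] := pP i.
exists (Tof md).
  by rewrite (lt_le_trans Tb0)// lerDl sumr_ge0.
move=> xb xd u0 ud xhb xhd y0 yb yd cxb cxd udL fxb fxd.
have xbE := xbT xb xd u0 ud xhb cxb cxd fxb.
have [acd [Z1 nZ1 dZ1]] := cxd; have [ach [Z2 nZ2 dZ2]] := fxd.
pose e (i : 'I_md) (j : nat) (t : R) := vcomp (xd t - xhd t) (boff q i + j).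
have eE (i : 'I_md) j (h : (boff q i + j < bdim q)%N) :
    e i j = fun t => xd t (Ordinal h) ord0 - xhd t (Ordinal h) ord0.
  by apply/funext => t; rewrite /e (vcomp_ord _ h) !mxE.
have jbound (i : 'I_md) j : (j <= (q i).-1)%N -> (boff q i + j < bdim q)%N.
  by move=> jn; apply: boff_lt; rewrite -(prednK (Hq i)) ltnS.
have ace (i : 'I_md) j T' : (j <= (q i).-1)%N -> 0 <= T' -> abs_cont 0 T' (e i j).
  by move=> /jbound h T'0; rewrite (eE _ _ h); apply: abs_contB; [exact: acd|exact: ach].
have nZ : (@lebesgue_measure R).-negligible (Z1 `|` Z2)%classic by exact: negligibleU.
have dyn i t : Tb <= t -> ~ (Z1 `|` Z2)%classic t ->
    (Fdd *m (xd t - xhd t)) i ord0 = 0 ->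
    error_dynamics (q i).-1 mu dinf L (p i).1 (e i) t.
  move=> Tbt nZt F0; have t0 : 0 <= t by rewrite (le_trans (ltW Tb0)).
  have [|dxd xdE] := dZ1 t t0; first by move=> ?; apply: nZt; left.
  have [|dxh xhF] := dZ2 t t0; first by move=> ?; apply: nZt; right.
  (* After [Tb] the estimate [xhb t] equals [xb t], so the plant and the observer share this
     term. *)
  pose w := Bblk q *m Fdb *m xb t + Hdd *m yd t + B0d *m y0 t.
  have dxE : dvec xd t = Jblk q *m xd t + Bblk q *m (Fdd *m xd t) + w + Bblk q *m ud t.
    rewrite xdE /w /yd !mulmxDl !mulmxA; congr (_ + _).
    rewrite [X in X + _ = _]addrC -!addrA; congr (_ + (_ + _)).
    by rewrite addrCA.
  have fE : (fun xi => (Jblk q + Bblk q *m Fdd) *m xi + Bblk q *m Fdb *m xhb t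
      + B0d *m y0 t + Hdd *m yd t + linj q mu (-1) dinf (fun i => (p i).1) (yd t - Cblk q *m xi))
    = (fun xi => Jblk q *m xi + Bblk q *m (Fdd *m xi) + w
      + linj q mu (-1) dinf (fun i => (p i).1) (Cblk q *m xd t - Cblk q *m xi)).
    apply/funext => xi; rewrite /w /yd -xbE// mulmxDl !mulmxA; congr (_ + _).
    by rewrite -!addrA; congr (_ + (_ + (_ + _))); rewrite addrC.
  rewrite fE in xhF.
  have g0 : 0 < (p i).1 (q i).
    by have [pp _ _] := pP i; apply: pp; rewrite Hq leqnn.
  have [inner [xi [last xi1 xi2]]] :=
    block_error_velocity mu01 dinf0 (dinfq i) (Hq i) g0 dxE xhF F0.
  have der j : (j <= (q i).-1)%N -> derivable (e i j) t 1 /\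
      derive1 (e i j) t = vcomp (dvec xd t - dvec xhd t) (boff q i + j).
    move=> /jbound h; rewrite (eE _ _ h) (vcomp_ord _ h) !mxE; split.
      exact: derivableB.
    by rewrite derive1E deriveB// -!derive1E.
  split.
  - by move=> j /der[].
  - by move=> j jn; rewrite (der j (ltnW jn)).2 inner// prednK.
  - exists (ud t i ord0), xi; split.
    + exact: udL.
    + by rewrite (der _ (leqnn _)).2 last prednK.
    + by rewrite prednK.
    + by [].
have Tof_le a b : (a <= b)%N -> Tof a <= Tof b.
  move=> ab; rewrite lerD2l big_mkcond [leRHS]big_mkcond; apply: ler_sum => i _ /=.
  by case: ifP => [ia|_]; [rewrite (leq_trans ia ab)|case: ifP].
have TofS (i : 'I_md) : Tof i.+1 = Tof i + (p i).2.
  rewrite /Tof -addrA (bigD1 i)//= [_ + (p i).2]addrC; congr (_ + (_ + _)).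
  by apply: eq_bigl => j; rewrite ltnS [RHS]ltn_neqAle andbC.
have vanish m (i : 'I_md) : (i < m)%N -> forall j, (j < q i)%N ->
    forall t, Tof i.+1 <= t -> e i j t = 0.
  elim: m i => [//|m IH] i; rewrite ltnS => im j jq t; rewrite TofS => Tt.
  have jn : (j <= (q i).-1)%N by rewrite -ltnS prednK.
  have Tbi : Tb <= Tof i by rewrite lerDl sumr_ge0.
  have [_ _ pT] := pP i.
  apply: (pT (e i) (Tof i) _ _ (fun j T' => @ace i j T') nZ) => //.
    by rewrite (le_trans (ltW Tb0)).
  move=> s Tis nZs; apply: dyn => //; first exact: le_trans Tis.
  (* A column of an earlier block meets an error that is already zero; on the other columns the
     entry of [Fdd] is zero. *)
  rewrite mxE big1// => c _.
  have [i' [j' [j'q cE]]] := bdim_split (ltn_ord c).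
  have [i'i|ii'] := ltnP i' i; last by rewrite (HFdd i i' j' c)// ?mul0r//; left.
  rewrite -vcompE cE -/(e i' j' s) (IH i' _ j' j'q) ?mulr0//.
    exact: leq_trans im.
  by rewrite (le_trans (Tof_le _ _ i'i)).
move=> t Tt; apply/colP => c; apply/eqP; rewrite -subr_eq0; apply/eqP.
have [i [j [jq cE]]] := bdim_split (ltn_ord c).
have := vanish md i (ltn_ord i) j jq t (le_trans (Tof_le _ _ (ltn_ord i)) Tt).
by rewrite /e -cE vcompE !mxE.
Qed.
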